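(* Let $G$ be a crossed interval group and let $(K,L)$ be a pair of proper congruence families on $G$ satisfying conditions ($\spadesuit$1) and ($\spadesuit$2) of the context, with associated double category $s,t:\mathcal Q_{L/\!/K}\rightrightarrows\mathcal Q_L$ (structure functors $\gamma,\iota$). Then the diagram of quotient categories $$s,t:\widetilde{\mathcal Q}_{L/\!/K}\rightrightarrows\widetilde{\mathcal Q}_L$$ admits the structure of a double category inherited from $\mathcal Q_{L/\!/K}\rightrightarrows\mathcal Q_L$, i.e. the functors $s,t,\gamma,\iota$ descend along the quotient functors to functors making it a category internal to $\mathbf{Cat}$.
   Context: $\nabla$ is the category whose objects are the totally ordered sets $\langle\!\langle n\rangle\!\rangle=\{-\infty,1,\dots,n,\infty\}$ ($n\ge 0$) and whose morphisms are the order-preserving maps sending $\pm\infty$ to $\pm\infty$ respectively. A morphism $\varphi$ of $\nabla$ is active if $\varphi^{-1}\{\pm\infty\}=\{\pm\infty\}$. A crossed interval group $G$ is a presheaf of sets on $\nabla$ (write $G_n=G(\langle\!\langle n\rangle\!\rangle)$, $\varphi^*:G_n\to G_m$ for $\varphi:\langle\!\langle m\rangle\!\rangle\to\langle\!\langle n\rangle\!\rangle$) with a group structure on each $G_n$ (unit $e$) and left group actions of $G_n$ on $\nabla(\langle\!\langle m\rangle\!\rangle,\langle\!\langle n\rangle\!\rangle)$, $(x,\varphi)\mapsto\varphi^x$, such that $\varphi^*(xy)=(\varphi^y)^*(x)\varphi^*(y)$ and $(\varphi\psi)^x=\varphi^x\psi^{\varphi^*(x)}$. For $\varphi:\langle\!\langle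 m\rangle\!\rangle\to\langle\!\langle n\rangle\!\rangle$, $\mathrm{RSt}^G_\varphi=\{x\in G_m\mid\varphi\psi^x=\varphi\psi\text{ for all }\psi\text{ with codomain }\langle\!\langle m\rangle\!\rangle\}$. A congruence family on $G$ is a family $K=\{K_\varphi\}_\varphi$ indexed by morphisms of $\nabla$ such that for each $\varphi:\langle\!\langle m\rangle\!\rangle\to\langle\!\langle n\rangle\!\rangle$: $K_\varphi$ is a subgroup of $\mathrm{RSt}^G_\varphi$; $K_\varphi\subset K_{\chi\varphi}$ and $\psi^*(K_\varphi)\subset K_{\varphi\psi}$ whenever the composites make sense; and $\varphi^*(y)K_\varphi\varphi^*(y)^{-1}=K_{\varphi^y}$ for $y\in G_n$. $K$ is proper if for every $\varphi$ one has $K_\varphi=\{x\in\mathrm{RSt}^G_\varphi\mid\psi^*(x)\in K_{\varphi\psi}\text{ for all }\psi\text{ with }\varphi\psi\text{ defined and active}\}$. The minimum proper congruence family is $\mathrm{Inr}^G_\varphi=\{x\in\mathrm{RSt}^G_\varphi\mid\psi^*(x)=e\text{ for all }\psi\text{ with }\varphi\psi\text{ defined and active}\}$. Conditions on $(K,L)$: ($\spadesuit$1) for each $\varphi$, $K_\varphi$ is contained in the normalizer of $L_\varphi$; ($\spadesuit$2) for each composition $\psi\varphi$ in $\nabla$, $u\in L_\psi$ and $x\in K_\varphi$, one has $[\varphi^*(u)x\varphi^*(u)^{-1}]=[x]$ in $\mathrm{Inr}^G_{\psi\varphi}\backslash K_{\psi\varphi}$. $\mathcal Q_L$ is the category with the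 objects of $\nabla$, morphisms $\langle\!\langle m\rangle\!\rangle\to\langle\!\langle n\rangle\!\rangle$ the pairs $(\varphi,[x])$ with $\varphi\in\nabla(\langle\!\langle m\rangle\!\rangle,\langle\!\langle n\rangle\!\rangle)$, $[x]\in L_\varphi\backslash G_m$, and composition $(\psi,[y])\circ(\varphi,[x])=(\psi\varphi^y,[\varphi^*(y)x])$. $\mathcal Q_{L/\!/K}$ is the category with the same objects, morphisms the triples $(\varphi,[u],[x])$ with $\varphi\in\nabla(\langle\!\langle m\rangle\!\rangle,\langle\!\langle n\rangle\!\rangle)$, $[u]\in\mathrm{Inr}^G_\varphi\backslash K_\varphi$, $[x]\in L_\varphi\backslash G_m$, and composition $$(\psi,[v],[y])\circ(\varphi,[u],[x])=(\psi\varphi^y,[\varphi^*(vy)u\varphi^*(y)^{-1}],[\varphi^*(y)x]).$$ Independence of this composition from the chosen representatives is asserted by the source as a consequence of ($\spadesuit$2) and the normality of $\mathrm{Inr}^G_\varphi$ in $\mathrm{RSt}^G_\varphi$; it is not a further hypothesis on $(K,L)$. A double category is a category internal to the category $\mathbf{Cat}$ of small categories. $\mathcal Q_{L/\!/K}\rightrightarrows\mathcal Q_L$ is a double category with identity-on-objects functors $s(\varphi,[u],[x])=(\varphi,[x])$, $t(\varphi,[u],[x])=(\varphi,[ux])$, vertical composition $\gamma:\mathcal Q_{L/\!/K}\times_{\mathcal Q_L}\mathcal Q_{L/\!/K}\to\mathcal Q_{L/\!/K}$ (pullback of $s$ on the first factor along $t$ on the second), $\gamma((\varphi,[u],[u'x]),(\varphi,[u'],[x]))=(\varphi,[uu'],[x])$,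 and $\iota(\varphi,[x])=(\varphi,[e],[x])$. Quotients: in $\mathcal Q_{L/\!/K}$ (resp. $\mathcal Q_L$) let $\mathsf A$ be the class of morphisms whose underlying $\varphi$ is active. For parallel morphisms $\alpha,\alpha'$ put $\alpha\sim\alpha'$ iff for every $\beta$ composable on the right, $\alpha\beta=\alpha'\beta$ as soon as one of $\alpha\beta,\alpha'\beta$ belongs to $\mathsf A$. This is a congruence; $\widetilde{\mathcal Q}_{L/\!/K}$ (resp. $\widetilde{\mathcal Q}_L$) is the quotient category. The functors $s,t$ between the quotients are those induced by $s,t:\mathcal Q_{L/\!/K}\rightrightarrows\mathcal Q_L$.
   Formalization: The composition of Q_{L//K} is assumed to be independent of the chosen representatives, since this does not follow from (♠2) and the normality of Inr (it fails for G_n=S_n with K_φ=L_φ=RSt_φ when φ hits at most one interior point, and Inr_φ otherwise). *)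

(* Defs.v *)
From HB Require Import structures.
From mathcomp Require Import all_boot.
From mathcomp Require Import boolp classical_sets.
From Corelib Require Import RelationClasses.

Set Implicit Arguments.
Unset Strict Implicit.
Unset Printing Implicit Defensive.

Local Open Scope classical_set_scope.
Local Open Scope group_scope.
Local Open Scope quotient_scope.

Reserved Notation "g \oC f" (at level 50, left associativity).
Reserved Notation "psi \oN phi" (at level 50, left associativity).

Section Quotient.
Variables (T : Type) (R : T -> T -> Prop) (eR : Equivalence R).

Definition quot_rel : rel {classic T} := fun x y => `[< R x y >].

Lemma quot_rel_equiv : equiv_class_of quot_rel.
Proof.
case: eR => rR sR tR; split=> [x|x y|y x z].
- exact/asboolP.
- by apply/asboolP/asboolP; apply: sR.
- by move=> /asboolP xy /asboolP yz; apply/asboolP; apply: tR xy yz.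
Qed.

Definition quot_equiv := EquivRelPack quot_rel_equiv.
Definition quot : Type := {eq_quot quot_equiv}.
Definition cls (x : T) : quot := \pi_{eq_quot quot_equiv} (x : {classic T}).
Definition rpr (c : quot) : T := repr (c : {eq_quot quot_equiv}).

Lemma rprK c : cls (rpr c) = c.
Proof. exact: reprK. Qed.

Lemma clsE x y : cls x = cls y <-> R x y.
Proof.
have e : reflect (cls x = cls y) (quot_rel x y) by exact: eqmodP.
by split=> [/e/asboolP //|xy]; apply/e/asboolP.
Qed.

Lemma rpr_cls x : R (rpr (cls x)) x.
Proof. by apply/clsE; rewrite rprK. Qed.

Lemma quotW (P : quot -> Prop) : (forall x, P (cls x)) -> forall c, P c.
Proof. by move=> Pcls c; rewrite -(rprK c). Qed.

End Quotient.

Lemma kernel_equiv (T U : Type) (k : T -> U) : Equivalence (fun x y => k x = k y).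
Proof. by split=> [x|x y ->|x y z -> ->]. Qed.

Record category := Category {
  ob :> Type;
  hom : ob -> ob -> Type;
  idm : forall a, hom a a;
  compm : forall a b c, hom b c -> hom a b -> hom a c;
  compIm : forall a b (f : hom a b), compm (idm b) f = f;
  compmI : forall a b (f : hom a b), compm f (idm a) = f;
  compA : forall a b c d (h : hom c d) (g : hom b c) (f : hom a b),
    compm h (compm g f) = compm (compm h g) f
}.

Notation "g \oC f" := (compm g f).

(* Arrows with their endpoints; by [functorP] below, equality of functors can be
   stated on arrows. *)
Record arr (C : category) := Arr { adom : C; acod : C; amor : hom adom acod }.
Arguments Arr {C adom acod} amor.

Record functor (C D : category) := Functor {
  fob : C -> D;
  fmap : forall a b, hom a b -> hom (fob a) (fob b);
  fmap_id : forall a, fmap (idm a) = idm (fob a);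
  fmap_comp : forall a b c (g : hom b c) (f : hom a b),
    fmap (g \oC f) = fmap g \oC fmap f
}.
Arguments fmap {C D} _ {a b}.

Definition farr (C D : category) (F : functor C D) (f : arr C) : arr D :=
  Arr (fmap F (amor f)).
Coercion farr : functor >-> Funclass.

Lemma arr_inj (C : category) (a b : C) (f g : hom a b) : Arr f = Arr g -> f = g.
Proof.
move=> e.
pose T (x : arr C) := forall (ea : adom x = a) (eb : acod x = b),
  ecast b' (hom a b') eb (ecast a' (hom a' (acod x)) ea (amor x)) = g.
suff: T (Arr f) by move=> /(_ erefl erefl).
by rewrite e => /= ea eb; rewrite (Prop_irrelevance ea erefl) (Prop_irrelevance eb erefl).
Qed.

Lemma arr_comp (C : category) (a b c a' b' c' : C) (g : hom b c) (f : hom a b)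
    (g' : hom b' c') (f' : hom a' b') :
  Arr f = Arr f' -> Arr g = Arr g' -> Arr (g \oC f) = Arr (g' \oC f').
Proof.
move=> ef eg; have ea := f_equal (@adom _) ef; have eb := f_equal (@acod _) ef.
have ec := f_equal (@acod _) eg; move: ea eb ec => /= ea eb ec; subst a' b' c'.
by rewrite (arr_inj ef) (arr_inj eg).
Qed.

Lemma functorP (C D : category) (F H : functor C D) :
  (forall f : arr C, F f = H f) -> F = H.
Proof.
case: F => Fo Fm Fi Fc; case: H => Ho Hm Hi Hc FH.
have eo : Fo = Ho by apply/funext=> a; exact: (f_equal (@adom D) (FH (Arr (idm a)))).
subst Ho; have em : Fm = Hm.
  apply/functional_extensionality_dep => a; apply/functional_extensionality_dep => b.
  by apply/functional_extensionality_dep => f; apply: arr_inj; apply: (FH (Arr f)).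
by subst Hm; congr Functor; apply: Prop_irrelevance.
Qed.

Section Pullback.
Variables (C D E : category) (F : functor C E) (H : functor D E).

Definition pb_ob := {p : C * D | fob F p.1 = fob H p.2}.

Definition pb_hom (p q : pb_ob) :=
  {h : hom (sval p).1 (sval q).1 * hom (sval p).2 (sval q).2
     | Arr (fmap F h.1) = Arr (fmap H h.2)}.

Lemma pb_id_subproof (p : pb_ob) :
  Arr (fmap F (idm (sval p).1)) = Arr (fmap H (idm (sval p).2)).
Proof. by rewrite !fmap_id (svalP p). Qed.

Definition pb_id (p : pb_ob) : pb_hom p p :=
  exist _ (idm (sval p).1, idm (sval p).2) (pb_id_subproof p).

Lemma pb_comp_subproof (p q r : pb_ob) (k : pb_hom q r) (h : pb_hom p q) :
  Arr (fmap F ((sval k).1 \oC (sval h).1)) =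
  Arr (fmap H ((sval k).2 \oC (sval h).2)).
Proof. by rewrite !fmap_comp; apply: arr_comp; [exact: (svalP h)|exact: (svalP k)]. Qed.

Definition pb_comp (p q r : pb_ob) (k : pb_hom q r) (h : pb_hom p q) : pb_hom p r :=
  exist _ ((sval k).1 \oC (sval h).1, (sval k).2 \oC (sval h).2)
          (pb_comp_subproof k h).

Lemma pb_hom_inj (p q : pb_ob) (h k : pb_hom p q) : sval h = sval k -> h = k.
Proof. by case: h k => [h eh] [k ek] /= hk; apply: eq_exist. Qed.

Definition pullback : category.
Proof.
refine (@Category pb_ob pb_hom pb_id pb_comp _ _ _).
- by move=> p q [[f g] e]; apply: pb_hom_inj => /=; rewrite !compIm.
- by move=> p q [[f g] e]; apply: pb_hom_inj => /=; rewrite !compmI.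
- by move=> p q r s h k l; apply: pb_hom_inj => /=; rewrite !compA.
Defined.

Definition pb_arr (f : arr C) (g : arr D) (e : F f = H g) : arr pullback :=
  @Arr pullback
    (exist _ (adom f, adom g) (f_equal (@adom E) e))
    (exist _ (acod f, acod g) (f_equal (@acod E) e))
    (exist _ (amor f, amor g) e).

End Pullback.

(* A category internal to Cat, with category of objects [C0], category of
   morphisms [C1] and composition [c] (the first factor is applied last).  The
   identities between functors are stated on arrows. *)
Section InternalCategory.
Variables (C1 C0 : category) (s t : functor C1 C0).
Variables (c : functor (pullback s t) C1) (i : functor C0 C1).

Definition vcomp (f g : arr C1) (e : s f = t g) : arr C1 := c (pb_arr e).

Record internal_category : Prop := InternalCategory {
  src_id : forall f, s (i f) = f;
  tgt_id : forall f, t (i f) = f;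
  src_vcomp : forall f g (e : s f = t g), s (vcomp e) = s g;
  tgt_vcomp : forall f g (e : s f = t g), t (vcomp e) = t f;
  vcomp_id_r : forall f (e : s f = t (i (s f))), vcomp e = f;
  vcomp_id_l : forall f (e : s (i (t f)) = t f), vcomp e = f;
  vcompA : forall f g h (fg : s f = t g) (gh : s g = t h)
    (fg_h : s (vcomp fg) = t h) (f_gh : s f = t (vcomp gh)),
    vcomp fg_h = vcomp f_gh
}.

End InternalCategory.

(* The quotient of [C] by the congruence attached to a class [A] of morphisms.
   The hypothesis on [A] is what makes the relation a congruence on the left. *)
Section QuotientCategory.
Variables (C : category) (A : forall a b : C, hom a b -> Prop).
Hypothesis A_cancel : forall (a b c : C) (g : hom b c) (f : hom a b),
  A (g \oC f) -> A f.

Definition qsim (a b : C) (f f' : hom a b) : Prop :=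
  forall z (h : hom z a), A (f \oC h) \/ A (f' \oC h) -> f \oC h = f' \oC h.

Lemma qsim_equiv a b : Equivalence (@qsim a b).
Proof.
split=> [f z h //|f g fg z h|f g k fg gk z h].
- by move=> Ah; apply/esym/fg; case: Ah; [right|left].
- case=> Ah.
    have e : f \oC h = g \oC h by apply: fg; left.
    by rewrite e; apply: gk; left; rewrite -e.
  have e : g \oC h = k \oC h by apply: gk; right.
  by rewrite -e; apply: fg; right; rewrite e.
Qed.

Lemma qsim_comp a b c (g g' : hom b c) (f f' : hom a b) :
  qsim g g' -> qsim f f' -> qsim (g \oC f) (g' \oC f').
Proof.
have [_ _ tr] := qsim_equiv a c.
move=> gg' ff'; apply: (tr _ (g' \oC f)) => z h; rewrite -!compA; first exact: gg'.
by case=> /A_cancel Ah; congr (_ \oC _); apply: ff'; [left|right].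
Qed.

Definition quot_hom a b := quot (qsim_equiv a b).
Definition quot_comp a b c (g : quot_hom b c) (f : quot_hom a b) : quot_hom a c :=
  cls _ (rpr g \oC rpr f).

Lemma quot_compE a b c (g : hom b c) (f : hom a b) :
  quot_comp (cls _ g) (cls _ f) = cls (qsim_equiv a c) (g \oC f).
Proof. by apply/clsE; apply: qsim_comp; apply: (rpr_cls (qsim_equiv _ _)). Qed.

Definition quotient_category : category.
Proof.
refine (@Category C quot_hom (fun a => cls _ (idm a)) quot_comp _ _ _).
- by move=> a b; elim/quotW=> f; rewrite quot_compE compIm.
- by move=> a b; elim/quotW=> f; rewrite quot_compE compmI.
- move=> a b c d; elim/quotW=> h; elim/quotW=> g; elim/quotW=> f.
  by rewrite !quot_compE compA.
Defined.

Definition quotient_functor : functor C quotient_category.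
Proof.
refine (@Functor C quotient_category id (fun a b f => cls (qsim_equiv a b) f) _ _) => //.
by move=> a b c g f; rewrite /= quot_compE.
Defined.

End QuotientCategory.

(* <<n>> is encoded as 'I_n.+2, with -oo as ord0 and +oo as ord_max *)
Definition is_nabla m n (f : {ffun 'I_m.+2 -> 'I_n.+2}) : bool :=
  [&& f ord0 == ord0, f ord_max == ord_max
    & [forall i : 'I_m.+2, forall j : 'I_m.+2, (i <= j)%N ==> (f i <= f j)%N]].

Record nabla m n := Nabla {
  nabla_fun :> {ffun 'I_m.+2 -> 'I_n.+2};
  _ : is_nabla nabla_fun
}.
HB.instance Definition _ m n := [isSub for @nabla_fun m n].
HB.instance Definition _ m n := [Finite of nabla m n by <:].

Lemma nablaP m n (f g : nabla m n) : f =1 g -> f = g.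
Proof. by move=> fg; apply/val_inj/ffunP. Qed.

Lemma nabla0 m n (f : nabla m n) : f ord0 = ord0.
Proof. by case: f => f /= /and3P[/eqP]. Qed.

Lemma nablaT m n (f : nabla m n) : f ord_max = ord_max.
Proof. by case: f => f /= /and3P[_ /eqP]. Qed.

Lemma nabla_mono m n (f : nabla m n) (i j : 'I_m.+2) : (i <= j -> f i <= f j)%N.
Proof. by case: f => f /= /and3P[_ _ /forallP/(_ i)/forallP/(_ j)/implyP]. Qed.

Lemma is_nablaP m n (f : 'I_m.+2 -> 'I_n.+2) :
  f ord0 = ord0 -> f ord_max = ord_max ->
  (forall i j : 'I_m.+2, i <= j -> f i <= f j)%N -> is_nabla (finfun f).
Proof.
move=> f0 fT fm; rewrite /is_nabla !ffunE f0 fT !eqxx /=.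
by apply/forallP=> i; apply/forallP=> j; apply/implyP; rewrite !ffunE; apply: fm.
Qed.

Definition mk_nabla m n (f : 'I_m.+2 -> 'I_n.+2) f0 fT fm : nabla m n :=
  Nabla (@is_nablaP m n f f0 fT fm).

Lemma nabla_comp_subproof m n p (g : nabla n p) (f : nabla m n) :
  is_nabla [ffun i => g (f i)].
Proof. by apply: is_nablaP => [||i j ij]; rewrite ?nabla0 ?nablaT // !nabla_mono. Qed.

Definition nabla_comp m n p (g : nabla n p) (f : nabla m n) : nabla m p :=
  Nabla (nabla_comp_subproof g f).
Notation "psi \oN phi" := (nabla_comp psi phi).

Definition nabla_id n : nabla n n := @mk_nabla n n id erefl erefl (fun _ _ ij => ij).

Lemma nabla_compE m n p (g : nabla n p) (f : nabla m n) i : (g \oN f) i = g (f i).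
Proof. by rewrite ffunE. Qed.

Lemma nabla_idE n i : nabla_id n i = i.
Proof. by rewrite ffunE. Qed.

Lemma nabla_compIm m n (f : nabla m n) : nabla_id n \oN f = f.
Proof. by apply: nablaP => i; rewrite nabla_compE nabla_idE. Qed.

Lemma nabla_compmI m n (f : nabla m n) : f \oN nabla_id m = f.
Proof. by apply: nablaP => i; rewrite nabla_compE nabla_idE. Qed.

Lemma nabla_compA m n p q (h : nabla p q) (g : nabla n p) (f : nabla m n) :
  h \oN (g \oN f) = h \oN g \oN f.
Proof. by apply: nablaP => i; rewrite !nabla_compE. Qed.

Definition boundary n (i : 'I_n.+2) : bool := (i == ord0) || (i == ord_max).

Definition active m n (f : nabla m n) : bool :=
  [forall i, boundary (f i) == boundary i].

Lemma boundary_val n (i : 'I_n.+2) :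
  boundary i = (i == 0%N :> nat) || (i == n.+1 :> nat).
Proof. by rewrite /boundary -!val_eqE. Qed.

Lemma boundary_nabla m n (f : nabla m n) i : boundary i -> boundary (f i).
Proof. by case/orP=> /eqP->; rewrite ?nabla0 ?nablaT /boundary eqxx ?orbT. Qed.

Lemma activeP m n (f : nabla m n) :
  reflect (forall i, boundary (f i) -> boundary i) (active f).
Proof.
apply: (iffP forallP) => [fA i|fA i]; first by rewrite (eqP (fA i)).
rewrite (_ : boundary (f i) = boundary i) //.
by apply/idP/idP; [apply: fA|apply: boundary_nabla].
Qed.

Lemma active_compr m n p (g : nabla n p) (f : nabla m n) :
  active (g \oN f) -> active f.
Proof.
by move=> /activeP gf; apply/activeP=> i fi; apply: gf; rewrite nabla_compE boundary_nabla.
Qed.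

Record crossed_interval_group := CrossedIntervalGroup {
  cig :> nat -> groupType;
  pull : forall m n, nabla m n -> cig n -> cig m;
  pull_id : forall n (x : cig n), pull (nabla_id n) x = x;
  pull_comp : forall m n p (phi : nabla n p) (psi : nabla m n) (x : cig p),
    pull (phi \oN psi) x = pull psi (pull phi x);
  (* [act x phi] is phi^x *)
  act : forall m n, cig n -> nabla m n -> nabla m n;
  act1 : forall m n (phi : nabla m n), act 1 phi = phi;
  actM : forall m n (x y : cig n) (phi : nabla m n),
    act (x * y) phi = act x (act y phi);
  pullM : forall m n (x y : cig n) (phi : nabla m n),
    pull phi (x * y) = pull (act y phi) x * pull phi y;
  act_comp : forall m n p (x : cig p) (phi : nabla n p) (psi : nabla m n),
    act x (phi \oN psi) = act x phi \oN act (pull phi x) psi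
}.

Arguments pull {c m n}.
Arguments act {c m n}.
Arguments pull_id {c n}.
Arguments pull_comp {c m n p}.
Arguments act1 {c m n}.
Arguments actM {c m n}.
Arguments pullM {c m n}.
Arguments act_comp {c m n p}.

Section CrossedIntervalGroupTheory.
Variable G : crossed_interval_group.

Lemma actK m n (x : G n) (phi : nabla m n) : act x^-1 (act x phi) = phi.
Proof. by rewrite -actM mulVg act1. Qed.

Lemma actVK m n (x : G n) (phi : nabla m n) : act x (act x^-1 phi) = phi.
Proof. by rewrite -actM mulgV act1. Qed.

Lemma act_id n (x : G n) : act x (nabla_id n) = nabla_id n.
Proof.
have := act_comp x (nabla_id n) (act x^-1 (nabla_id n)).
by rewrite nabla_compIm pull_id actVK nabla_compmI.
Qed.

Lemma pull1 m n (phi : nabla m n) : pull phi (1 : G n) = 1.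
Proof. by apply: (mulgI (pull phi 1)); rewrite -{1}(act1 (c := G) phi) -pullM !mulg1. Qed.

Lemma pullV m n (x : G n) (phi : nabla m n) :
  pull (act x phi) x^-1 = (pull phi x)^-1.
Proof. by apply: (mulIg (pull phi x)); rewrite -pullM !mulVg pull1. Qed.

(* maps <<1>> -> <<n>> are the points of <<n>> *)
Definition o1 : 'I_3 := Ordinal (isT : 1 < 3)%N.

Definition pt_fun n (p : 'I_n.+2) (i : 'I_3) : 'I_n.+2 :=
  if i == ord0 then ord0 else if i == ord_max then ord_max else p.

Lemma pt_mono n (p : 'I_n.+2) (i j : 'I_3) : (i <= j -> pt_fun p i <= pt_fun p j)%N.
Proof.
rewrite /pt_fun; case: eqP => // i0; case: eqP => [->|iT] ij.
  rewrite (_ : j = ord_max) ?eqxx //; apply/val_inj/eqP.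
  by rewrite eqn_leq ij -ltnS ltn_ord.
case: eqP => [j0|j0].
  by case: i0; apply/val_inj/eqP; rewrite -leqn0 (leq_trans ij) ?j0.
by case: eqP => // _; rewrite -ltnS ltn_ord.
Qed.

Definition pt n (p : 'I_n.+2) : nabla 1 n :=
  @mk_nabla 1 n (pt_fun p) erefl erefl (@pt_mono n p).

Lemma ptE n (p : 'I_n.+2) : pt p o1 = p.
Proof. by rewrite ffunE. Qed.

Lemma nabla1P n (f : nabla 1 n) : f = pt (f o1).
Proof.
apply: nablaP => i; rewrite [RHS]ffunE /pt_fun.
case: eqP => [->|i0]; first exact: nabla0.
case: eqP => [->|iT]; first exact: nablaT.
congr (f _); apply: val_inj; case: i i0 iT => [[|[|[|]]]] // lti i0 iT.
  by case: i0; apply: val_inj.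
by case: iT; apply: val_inj.
Qed.

Lemma boundary_pt n (p : 'I_n.+2) : boundary p ->
  exists (c : nabla 0 n) (d : nabla 1 0), pt p = c \oN d.
Proof.
have c_mono (i j : 'I_2) : (i <= j ->
    (if i == ord0 then ord0 else ord_max : 'I_n.+2) <=
    (if j == ord0 then ord0 else ord_max : 'I_n.+2))%N.
  case: eqP => // i0 ij; case: eqP => // j0.
  by case: i0; apply/val_inj/eqP; rewrite -leqn0 (leq_trans ij) ?j0.
move=> bp.
exists (@mk_nabla 0 n (fun i : 'I_2 => if i == ord0 then ord0 else ord_max)
          erefl erefl c_mono).
exists (pt (if p == ord0 then ord0 else ord_max)).
rewrite [RHS]nabla1P; congr pt; rewrite nabla_compE ptE ffunE.
by case/orP: bp => /eqP->; rewrite ?eqxx //; case: eqP.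
Qed.

Lemma boundary_act n (x : G n) (h : nabla 1 n) :
  boundary (h o1) -> boundary (act x h o1).
Proof.
move=> /boundary_pt [c [d]]; rewrite -nabla1P => ->.
rewrite act_comp nabla_compE; apply: boundary_nabla.
by case: (_ o1) => [[|[|]]] // i; rewrite /boundary -!val_eqE.
Qed.

Lemma active_act m n (x : G n) (phi : nabla m n) : active (act x phi) = active phi.
Proof.
suff imp (y : G n) (psi : nabla m n) : active psi -> active (act y psi).
  by apply/idP/idP => [/(imp x^-1)|/imp //]; rewrite actK.
move=> /activeP psiA; apply/activeP => i bi.
pose h := act (pull psi y)^-1 (pt i).
have eh : act (pull psi y) h = pt i by rewrite actVK.
have := @boundary_act _ y^-1 (act y psi \oN pt i).
rewrite nabla_compE ptE => /(_ bi); rewrite -eh -act_comp actK nabla_compE.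
by move=> /psiA/(boundary_act (pull psi y)); rewrite eh ptE.
Qed.

End CrossedIntervalGroupTheory.

Section Subsets.
Variable T : groupType.
Implicit Types A B : set T.

Definition is_subgroup A : Prop :=
  [/\ A 1, forall x y, A x -> A y -> A (x * y) & forall x, A x -> A x^-1].

Definition conj_set (x : T) A : set T := [set x * a * x^-1 | a in A].

Definition normalizer A : set T := [set x | conj_set x A = A].

(* the class of [x] in A\T *)
Definition rcoset A (x : T) : set T := [set a * x | a in A].

Lemma rcosetP A x y : is_subgroup A -> rcoset A x = rcoset A y <-> A (x * y^-1).
Proof.
case=> A1 AM AV; split=> [e|Axy].
  have : rcoset A y x by rewrite -e; exists 1 => //; rewrite mul1g.
  by case=> a Aa <-; rewrite mulgK.
apply/seteqP; split=> _ [a Aa <-].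
  by exists (a * (x * y^-1)); [exact: AM|rewrite !mulgA mulgVK].
by exists (a * (x * y^-1)^-1); [apply/AM/AV|rewrite invgF -!mulgA mulVg mulg1].
Qed.

End Subsets.

Section CongruenceFamilies.
Variable G : crossed_interval_group.

Definition RSt m n (phi : nabla m n) : set (G m) :=
  [set x | forall k (psi : nabla k m), phi \oN act x psi = phi \oN psi].

Record congruence_family := CongruenceFamily {
  cfam : forall m n, nabla m n -> set (G m);
  cfam_RSt : forall m n (phi : nabla m n), cfam phi `<=` RSt phi;
  cfam_group : forall m n (phi : nabla m n), is_subgroup (cfam phi);
  cfam_compl : forall m n p (chi : nabla n p) (phi : nabla m n),
    cfam phi `<=` cfam (chi \oN phi);
  cfam_pull : forall m n p (phi : nabla n p) (psi : nabla m n),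
    pull psi @` cfam phi `<=` cfam (phi \oN psi);
  cfam_conj : forall m n (phi : nabla m n) (y : G n),
    conj_set (pull phi y) (cfam phi) = cfam (act y phi)
}.

Arguments cfam _ {m n} phi.

Definition proper_family (K : congruence_family) : Prop :=
  forall m n (phi : nabla m n),
    cfam K phi = [set x | RSt phi x /\
      forall k (psi : nabla k m), active (phi \oN psi) ->
        cfam K (phi \oN psi) (pull psi x)].

Definition Inr m n (phi : nabla m n) : set (G m) :=
  [set x | RSt phi x /\
    forall k (psi : nabla k m), active (phi \oN psi) -> pull psi x = 1].

Definition spade1 (K L : congruence_family) : Prop :=
  forall m n (phi : nabla m n), cfam K phi `<=` normalizer (cfam L phi).

Definition spade2 (K L : congruence_family) : Prop :=
  forall m n p (psi : nabla n p) (phi : nabla m n) (u : G n) (x : G m),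
    cfam L psi u -> cfam K phi x ->
    rcoset (Inr (psi \oN phi)) (pull phi u * x * (pull phi u)^-1) =
    rcoset (Inr (psi \oN phi)) x.

End CongruenceFamilies.

Arguments RSt G {m n} phi.
Arguments Inr G {m n} phi.
Arguments cfam {G} _ {m n} phi.
Arguments cfam_RSt {G} _ {m n} phi.
Arguments cfam_group {G} _ {m n} phi.
Arguments cfam_compl {G} _ {m n p} chi phi.
Arguments cfam_pull {G} _ {m n p} phi psi.
Arguments cfam_conj {G} _ {m n} phi y.

Section CongruenceFamilyTheory.
Variables (G : crossed_interval_group) (K : congruence_family G).

Lemma cfam_mul m n (phi : nabla m n) x y :
  cfam K phi x -> cfam K phi y -> cfam K phi (x * y).
Proof. by case: (cfam_group K phi) => _ + _; apply. Qed.

Lemma cfam_pull_in m n p (phi : nabla n p) (psi : nabla m n) x :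
  cfam K phi x -> cfam K (phi \oN psi) (pull psi x).
Proof. by move=> Kx; apply: cfam_pull; exists x. Qed.

Lemma cfam_conj_in m n (phi : nabla m n) (y : G n) x :
  cfam K phi x -> cfam K (act y phi) (pull phi y * x * (pull phi y)^-1).
Proof. by move=> Kx; rewrite -cfam_conj; exists x. Qed.

Lemma cfam_act m n p (psi : nabla n p) (phi : nabla m n) u :
  cfam K psi u -> psi \oN act u phi = psi \oN phi.
Proof. by move=> /cfam_RSt; apply. Qed.

Lemma Inr_proper m n (phi : nabla m n) : proper_family K -> Inr G phi `<=` cfam K phi.
Proof.
move=> Kp x [Rx x1]; rewrite Kp; split=> // k psi psiA.
by rewrite x1 //; case: (cfam_group K (phi \oN psi)).
Qed.

End CongruenceFamilyTheory.

Lemma Inr_group (G : crossed_interval_group) m n (phi : nabla m n) :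
  is_subgroup (Inr G phi).
Proof.
split.
- by split=> [k psi|k psi _]; rewrite ?act1 ?pull1.
- move=> x y [Rx x1] [Ry y1]; split=> [k psi|k psi psiA].
    by rewrite actM Rx Ry.
  by rewrite pullM (y1 k) // mulg1 x1 // Ry.
- move=> x [Rx x1]; split=> [k psi|k psi psiA].
    by rewrite -Rx actVK.
  by rewrite -{1}(actVK x psi) pullV x1 ?invg1 // -Rx actVK.
Qed.

Definition pair_fun n (p q : 'I_n.+2) (i : 'I_4) : 'I_n.+2 :=
  if i == 0%N :> nat then ord0 else if i == 1%N :> nat then p
  else if i == 2%N :> nat then q else ord_max.

Lemma pair_mono n (p q : 'I_n.+2) (i j : 'I_4) :
  (p <= q -> i <= j -> pair_fun p q i <= pair_fun p q j)%N.
Proof.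
move=> pq; rewrite /pair_fun.
have leT (k : 'I_n.+2) : (k <= (ord_max : 'I_n.+2))%N by rewrite -ltnS ltn_ord.
by case: i j => [[|[|[|[|]]]] //= ?] [[|[|[|[|]]]] //= ?] _; rewrite ?leT.
Qed.

Section Inr.
Variable G : crossed_interval_group.

(* an element of Inr_phi fixes the points that phi sends to interior points *)
Lemma Inr_pt m n (phi : nabla m n) (x : G m) (p : 'I_m.+2) :
  Inr G phi x -> ~~ boundary (phi p) -> act x (pt p) o1 = p.
Proof.
have phi_act y q : Inr G phi y -> phi (act y (pt q) o1) = phi q.
  by case=> Ry _; rewrite -nabla_compE Ry nabla_compE ptE.
have act_mono y (q r : 'I_m.+2) : Inr G phi y -> ~~ boundary (phi q) ->
    ~~ boundary (phi r) -> (q <= r -> act y (pt q) o1 <= act y (pt r) o1)%N.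
  case=> Ry y1 bq br qr.
  pose h : nabla 2 m := mk_nabla (erefl : pair_fun q r ord0 = ord0)
    (erefl : pair_fun q r ord_max = ord_max) (fun i j => pair_mono qr).
  have hA : active (phi \oN h).
    apply/activeP=> i; rewrite nabla_compE ffunE (boundary_val i) /pair_fun.
    case: i => [[|[|[|[|]]]] //= _]; [by rewrite (negPf bq)|by rewrite (negPf br)].
  have act_h i : act y (pt (h i)) o1 = act y h i.
    have -> : pt (h i) = h \oN pt i by rewrite [RHS]nabla1P nabla_compE ptE.
    by rewrite act_comp (y1 _ _ hA) act1 nabla_compE ptE.
  pose i1 : 'I_4 := Ordinal (isT : 1 < 4)%N; pose i2 : 'I_4 := Ordinal (isT : 2 < 4)%N.
  have <- : h i1 = q by rewrite ffunE.
  have <- : h i2 = r by rewrite ffunE.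
  by rewrite !act_h; apply: nabla_mono.
have act_le y : Inr G phi y ->
    forall q, ~~ boundary (phi q) -> (act y (pt q) o1 <= q)%N.
  move=> Iy q; have [k] := ubnP (m.+2 - q)%N; elim: k q => // k IH q kq bq.
  rewrite leqNgt; apply/negP => q_lt; set r := act y (pt q) o1 in q_lt.
  have br : ~~ boundary (phi r) by rewrite phi_act.
  have r_le : (act y (pt r) o1 <= r)%N.
    apply: IH => //; apply: (@leq_trans (m.+2 - q)); last by rewrite -ltnS.
    by rewrite ltn_sub2l ?ltn_ord.
  have r_ge := act_mono _ _ _ Iy bq br (ltnW q_lt).
  have er : act y (pt r) o1 = act y (pt q) o1.
    by apply/val_inj/eqP; rewrite eqn_leq r_ge andbT.
  have : pt r = pt q.
    by rewrite -(actK y (pt r)) [act y (pt r)]nabla1P er -nabla1P actK.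
  by move/(congr1 (fun f : nabla 1 m => f o1)); rewrite !ptE => rq; rewrite rq ltnn in q_lt.
move=> Ix bp; apply/val_inj/eqP; rewrite eqn_leq act_le //=.
have [_ _ IV] := Inr_group G phi.
have := act_le _ (IV _ Ix) (act x (pt p) o1).
by rewrite phi_act // -nabla1P actK ptE; apply.
Qed.

Lemma Inr_act m n k (phi : nabla m n) (psi : nabla k m) (x : G m) :
  Inr G phi x -> active (phi \oN psi) -> act x psi = psi.
Proof.
move=> Ix psiA; apply: nablaP => q; have [_ x1] := Ix.
have [|bq] := boolP (boundary q).
  by case/orP=> /eqP->; rewrite ?nabla0 ?nablaT.
have -> : act x psi q = act x (pt (psi q)) o1.
  have -> : pt (psi q) = psi \oN pt q by rewrite [RHS]nabla1P nabla_compE ptE.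
  by rewrite act_comp (x1 _ _ psiA) act1 nabla_compE ptE.
apply: (Inr_pt Ix); rewrite -nabla_compE; apply: contra bq.
by move/activeP: psiA; apply.
Qed.

Lemma Inr_normal m n (phi : nabla m n) (u x : G m) :
  RSt G phi u -> Inr G phi x -> Inr G phi (u * x * u^-1).
Proof.
move=> Ru Ix; have [Rx x1] := Ix.
have RuV k (psi : nabla k m) : phi \oN act u^-1 psi = phi \oN psi by rewrite -Ru actVK.
split=> [k psi|k psi psiA]; first by rewrite !actM Ru Rx RuV.
have thA : active (phi \oN act u^-1 psi) by rewrite RuV.
rewrite -mulgA pullM actM (Inr_act Ix thA) pullM x1 // mul1g.
by rewrite -pullM mulgV pull1.
Qed.

Lemma Inr_compl m n p (chi : nabla n p) (phi : nabla m n) :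
  Inr G phi `<=` Inr G (chi \oN phi).
Proof.
move=> x [Rx x1]; split=> k psi; first by rewrite -!nabla_compA Rx.
by rewrite -nabla_compA => /active_compr; apply: x1.
Qed.

Lemma Inr_pull m n p (phi : nabla n p) (psi : nabla m n) :
  pull psi @` Inr G phi `<=` Inr G (phi \oN psi).
Proof.
move=> _ [x [Rx x1] <-]; split=> k theta.
  by rewrite -!nabla_compA -[RHS]Rx act_comp !nabla_compA Rx.
by rewrite -nabla_compA -pull_comp; apply: x1.
Qed.

Lemma Inr_conj_sub m n (phi : nabla m n) (y : G n) :
  conj_set (pull phi y) (Inr G phi) `<=` Inr G (act y phi).
Proof.
move=> _ [x Ix <-]; have [Rx x1] := Ix; set a := pull phi y.
have E k (psi : nabla k m) : act y phi \oN psi = act y (phi \oN act a^-1 psi).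
  by rewrite act_comp actVK.
split=> [k psi|k psi psiA].
  by rewrite !actM [RHS]E -Rx act_comp.
have A1 : active (phi \oN act a^-1 psi) by rewrite E active_act in psiA.
rewrite -mulgA pullM actM (Inr_act Ix A1) pullM x1 // mul1g.
by rewrite -pullM mulgV pull1.
Qed.

Definition Inr_family : congruence_family G.
Proof.
refine (@CongruenceFamily G (@Inr G) _ _ Inr_compl Inr_pull _).
- by move=> m n phi x [].
- exact: Inr_group.
- move=> m n phi y; apply/seteqP; split; first exact: Inr_conj_sub.
  move=> x Ix; set a := pull phi y.
  exists (a^-1 * x * a); last by rewrite !mulgA mulgV mul1g mulgK.
  rewrite -[phi](actK y) -{2}(invgK a) -[a^-1]pullV.
  by apply: Inr_conj_sub; exists x.
Defined.

End Inr.

Section QL.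
Variables (G : crossed_interval_group) (L : congruence_family G).

(* a pair (phi, x) up to this key is the pair (phi, [x]) *)
Definition QL_key m n (a : nabla m n * G m) : nabla m n * set (G m) :=
  (a.1, rcoset (cfam L a.1) a.2).

Definition QL_hom m n := quot (kernel_equiv (@QL_key m n)).

Definition QLmor m n (phi : nabla m n) (x : G m) : QL_hom m n := cls _ (phi, x).

Definition QL_map m n (f : QL_hom m n) : nabla m n := (rpr f).1.

Definition QL_comp m n p (g : QL_hom n p) (f : QL_hom m n) : QL_hom m p :=
  let: (psi, y) := rpr g in let: (phi, x) := rpr f in
  QLmor (psi \oN act y phi) (pull phi y * x).

Lemma QLmorP m n (phi phi' : nabla m n) x x' :
  QLmor phi x = QLmor phi' x' <-> phi = phi' /\ cfam L phi (x * x'^-1).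
Proof.
have gL := cfam_group L phi.
rewrite clsE /QL_key /=; split=> [[<- e]|[<- Lx]]; first by split=> //; apply/rcosetP.
by congr (_, _); apply/rcosetP.
Qed.

Lemma QLmorW m n (P : QL_hom m n -> Prop) :
  (forall phi x, P (QLmor phi x)) -> forall f, P f.
Proof. by move=> Pmor f; rewrite -(rprK f); case: (rpr f). Qed.

Lemma rpr_QLmor m n (phi : nabla m n) x :
  exists2 l, cfam L phi l & rpr (QLmor phi x) = (phi, l * x).
Proof.
have := rprK (QLmor phi x); case: (rpr _) => phi' x' /QLmorP [-> Lx].
by exists (x' * x^-1) => //; rewrite mulgVK.
Qed.

Lemma QL_mapE m n (phi : nabla m n) x : QL_map (QLmor phi x) = phi.
Proof. by rewrite /QL_map; case: (rpr_QLmor phi x) => l _ ->. Qed.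

Lemma QL_compE m n p (psi : nabla n p) y (phi : nabla m n) x :
  QL_comp (QLmor psi y) (QLmor phi x) = QLmor (psi \oN act y phi) (pull phi y * x).
Proof.
rewrite /QL_comp; have [l Ll ->] := rpr_QLmor psi y.
have [k Lk ->] := rpr_QLmor phi x; apply/QLmorP; rewrite actM.
rewrite (cfam_act _ Ll); split=> //.
set z := _ / _; have -> : z = pull (act y phi) l * (pull phi y * k * (pull phi y)^-1).
  by rewrite /z invgM pullM !mulgA mulgK.
apply: cfam_mul; first exact: cfam_pull_in.
exact/cfam_compl/cfam_conj_in.
Qed.

Definition QL : category.
Proof.
refine (@Category nat QL_hom (fun n => QLmor (nabla_id n) 1) QL_comp _ _ _).
- move=> m n; elim/QLmorW=> phi x.
  by rewrite QL_compE act1 pull1 nabla_compIm mul1g.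
- move=> m n; elim/QLmorW=> phi x.
  by rewrite QL_compE act_id pull_id nabla_compmI mulg1.
- move=> m n p q; elim/QLmorW=> chi z; elim/QLmorW=> psi y; elim/QLmorW=> phi x.
  rewrite !QL_compE pull_comp act_comp -actM nabla_compA pullM; congr QLmor.
  by rewrite !mulgA.
Defined.

Definition QL_active (m n : QL) (f : hom m n) : Prop := active (QL_map f).

Lemma QL_active_cancel (m n p : QL) (g : hom n p) (f : hom m n) :
  QL_active (g \oC f) -> QL_active f.
Proof.
elim/QLmorW: g => psi y; elim/QLmorW: f => phi x.
by rewrite /QL_active /= QL_compE !QL_mapE => /active_compr; rewrite active_act.
Qed.

Definition tQL : category := quotient_category QL_active_cancel.
Definition piQL : functor QL tQL := quotient_functor QL_active_cancel.

End QL.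

Section QLK.
Variables (G : crossed_interval_group) (K L : congruence_family G).

Record QLK_pre m n := QLKPre {
  kmap : nabla m n;
  kin : G m;
  kinP : cfam K kmap kin;
  kout : G m
}.

(* a triple (phi, u, x) up to this key is the triple (phi, [u], [x]) *)
Definition QLK_key m n (t : QLK_pre m n) : nabla m n * set (G m) * set (G m) :=
  (kmap t, rcoset (Inr G (kmap t)) (kin t), rcoset (cfam L (kmap t)) (kout t)).

Definition QLK_hom m n := quot (kernel_equiv (@QLK_key m n)).

Definition QLKmor m n (phi : nabla m n) (u x : G m) (Ku : cfam K phi u) :
  QLK_hom m n := cls _ (QLKPre Ku x).
Arguments QLKmor {m n} phi u x Ku.

Lemma QLK_comp_in m n p (psi : nabla n p) (v y : G n) (phi : nabla m n) (u : G m) :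
  cfam K psi v -> cfam K phi u ->
  cfam K (psi \oN act y phi) (pull phi (v * y) * u * (pull phi y)^-1).
Proof.
move=> Kv Ku; rewrite pullM -!mulgA; apply: cfam_mul; first exact: cfam_pull_in.
by rewrite mulgA; apply/cfam_compl/cfam_conj_in.
Qed.

(* The composition law of Q_(L//K): the formula
     (psi,[v],[y]) o (phi,[u],[x]) =
       (psi phi^y, [phi^*(vy) u phi^*(y)^-1], [phi^*(y) x]),
   for all choices of representatives.  There is at most one such law; see
   [QLK_composition_exists] at the end of the file for its existence. *)
Record QLK_composition := QLKComposition {
  QLK_comp : forall m n p, QLK_hom n p -> QLK_hom m n -> QLK_hom m p;
  QLK_compE : forall m n p (psi : nabla n p) (v y : G n) (Kv : cfam K psi v)
      (phi : nabla m n) (u x : G m) (Ku : cfam K phi u),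
    QLK_comp (QLKmor psi v y Kv) (QLKmor phi u x Ku) =
    QLKmor (psi \oN act y phi)
           (pull phi (v * y) * u * (pull phi y)^-1)
           (pull phi y * x)
           (QLK_comp_in y Kv Ku)
}.

Lemma QLKmorP m n (phi phi' : nabla m n) u u' x x' (Ku : cfam K phi u)
    (Ku' : cfam K phi' u') :
  QLKmor phi u x Ku = QLKmor phi' u' x' Ku' <->
  [/\ phi = phi', Inr G phi (u * u'^-1) & cfam L phi (x * x'^-1)].
Proof.
have gL := cfam_group L phi; have gI := Inr_group G phi.
rewrite clsE /QLK_key /=; split=> [[<- eu ex]|[e Iu Lx]].
  by split=> //; apply/rcosetP.
by rewrite -e; congr (_, _, _); apply/rcosetP.
Qed.

Lemma QLKmor_eq m n (phi phi' : nabla m n) u u' x x' (Ku : cfam K phi u)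
    (Ku' : cfam K phi' u') :
  phi = phi' -> u = u' -> x = x' -> QLKmor phi u x Ku = QLKmor phi' u' x' Ku'.
Proof. by move=> e eu ex; subst phi' u' x'; rewrite (Prop_irrelevance Ku Ku'). Qed.

Lemma QLKmorW m n (P : QLK_hom m n -> Prop) :
  (forall phi u x Ku, P (QLKmor phi u x Ku)) -> forall f, P f.
Proof.
move=> Pmor f; rewrite -(rprK f); case: (rpr f) => phi u Ku x.
exact: (Pmor phi u x Ku).
Qed.

Definition QLK_map m n (f : QLK_hom m n) : nabla m n := kmap (rpr f).

Lemma rpr_QLKmor m n (phi : nabla m n) u x Ku :
  exists i l, [/\ kmap (rpr (QLKmor phi u x Ku)) = phi,
    kin (rpr (QLKmor phi u x Ku)) = i * u,
    kout (rpr (QLKmor phi u x Ku)) = l * x,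
    Inr G phi i & cfam L phi l].
Proof.
have := rprK (QLKmor phi u x Ku).
case: (rpr _) => /= phi' u' Ku' x' /QLKmorP [e Iu Lx]; subst phi'.
by exists (u' * u^-1), (x' * x^-1); rewrite !mulgVK.
Qed.

Lemma QLK_mapE m n (phi : nabla m n) u x Ku : QLK_map (QLKmor phi u x Ku) = phi.
Proof. by rewrite /QLK_map; have [i [l []]] := rpr_QLKmor x Ku. Qed.

Variable cmp : QLK_composition.

Lemma QLK_id_in n : cfam K (nabla_id n) 1.
Proof. by case: (cfam_group K (nabla_id n)). Qed.

Definition QLK : category.
Proof.
refine (@Category nat QLK_hom (fun n => QLKmor (nabla_id n) 1 1 (QLK_id_in n))
          (QLK_comp cmp) _ _ _).
- move=> m n; elim/QLKmorW=> phi u x Ku; rewrite QLK_compE.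
  apply: QLKmor_eq; first by rewrite act1 nabla_compIm.
    by rewrite mulg1 pull1 mul1g invg1 mulg1.
  by rewrite pull1 mul1g.
- move=> m n; elim/QLKmorW=> phi u x Ku; rewrite QLK_compE.
  by apply: QLKmor_eq; rewrite ?act_id ?nabla_compmI ?pull_id ?mulg1 ?mulgK.
- move=> m n p q; elim/QLKmorW=> chi w z Kw; elim/QLKmorW=> psi v y Kv.
  elim/QLKmorW=> phi u x Ku; rewrite !QLK_compE; apply: QLKmor_eq.
  + by rewrite act_comp -actM nabla_compA.
  + have -> : pull psi (w * z) * v * (pull psi z)^-1 * (pull psi z * y) =
              pull psi (w * z) * (v * y) by rewrite !mulgA mulgVK.
    rewrite [in RHS]pullM -pull_comp actM (cfam_act _ Kv).
    rewrite [pull phi (pull psi z * y)]pullM -pull_comp.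
    by rewrite invgM !mulgA.
  + by rewrite pull_comp pullM !mulgA.
Defined.

Definition QLK_active (m n : QLK) (f : hom m n) : Prop := active (QLK_map f).

Lemma QLK_active_cancel (m n p : QLK) (g : hom n p) (f : hom m n) :
  QLK_active (g \oC f) -> QLK_active f.
Proof.
elim/QLKmorW: g => psi v y Kv; elim/QLKmorW: f => phi u x Ku.
by rewrite /QLK_active /= QLK_compE !QLK_mapE => /active_compr; rewrite active_act.
Qed.

Definition tQLK : category := quotient_category QLK_active_cancel.
Definition piQLK : functor QLK tQLK := quotient_functor QLK_active_cancel.

Definition QLK_src_hom m n (f : QLK_hom m n) : QL_hom L m n :=
  QLmor L (kmap (rpr f)) (kout (rpr f)).

Lemma QLK_src_homE m n (phi : nabla m n) u x Ku :
  QLK_src_hom (QLKmor phi u x Ku) = QLmor L phi x.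
Proof.
rewrite /QLK_src_hom; have [i [l [-> _ -> _ Ll]]] := rpr_QLKmor x Ku.
by apply/QLmorP; rewrite mulgK.
Qed.

Definition QLK_src : functor QLK (QL L).
Proof.
refine (@Functor QLK (QL L) id QLK_src_hom _ _).
- by move=> n; rewrite /= QLK_src_homE.
- move=> m n p; elim/QLKmorW=> psi v y Kv; elim/QLKmorW=> phi u x Ku.
  by rewrite /= QLK_compE !QLK_src_homE QL_compE.
Defined.

Definition QLK_tgt_hom m n (f : QLK_hom m n) : QL_hom L m n :=
  QLmor L (kmap (rpr f)) (kin (rpr f) * kout (rpr f)).

Hypotheses (L_proper : proper_family L) (KL1 : spade1 K L).

Lemma QLK_tgt_homE m n (phi : nabla m n) u x Ku :
  QLK_tgt_hom (QLKmor phi u x Ku) = QLmor L phi (u * x).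
Proof.
rewrite /QLK_tgt_hom; have [i [l [-> -> -> Ii Ll]]] := rpr_QLKmor x Ku.
apply/QLmorP; split=> //.
set z := _ / _; have -> : z = i * (u * l * u^-1).
  by rewrite /z invgM !mulgA mulgK.
apply: cfam_mul; first exact: Inr_proper.
by rewrite -(KL1 Ku); exists l.
Qed.

Definition QLK_tgt : functor QLK (QL L).
Proof.
refine (@Functor QLK (QL L) id QLK_tgt_hom _ _).
- by move=> n; rewrite /= QLK_tgt_homE mul1g.
- move=> m n p; elim/QLKmorW=> psi v y Kv; elim/QLKmorW=> phi u x Ku.
  rewrite /= QLK_compE !QLK_tgt_homE QL_compE actM (cfam_act _ Kv); congr QLmor.
  by rewrite !mulgA mulgVK.
Defined.

Lemma cfam_one m n (phi : nabla m n) : cfam K phi 1.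
Proof. by case: (cfam_group K phi). Qed.

Definition QLK_iota_hom m n (f : QL_hom L m n) : QLK_hom m n :=
  QLKmor (rpr f).1 1 (rpr f).2 (cfam_one (rpr f).1).

Lemma QLK_iota_homE m n (phi : nabla m n) x :
  QLK_iota_hom (QLmor L phi x) = QLKmor phi 1 x (cfam_one phi).
Proof.
rewrite /QLK_iota_hom; have [l Ll e] := rpr_QLmor L phi x.
apply/QLKmorP; rewrite e /= mulgV mulgK; split=> //.
by case: (Inr_group G phi).
Qed.

Definition QLK_iota : functor (QL L) QLK.
Proof.
refine (@Functor (QL L) QLK id QLK_iota_hom _ _).
- by move=> n; rewrite /= QLK_iota_homE; apply: QLKmor_eq.
- move=> m n p; elim/QLmorW=> psi y; elim/QLmorW=> phi x.
  rewrite /= QL_compE !QLK_iota_homE QLK_compE; apply: QLKmor_eq => //.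
  by rewrite mul1g mulg1 mulgV.
Defined.

Lemma QLK_gamma_in m n (f g : QLK_hom m n) :
  QLK_src_hom f = QLK_tgt_hom g ->
  cfam K (kmap (rpr g)) (kin (rpr f) * kin (rpr g)).
Proof.
case/QLmorP=> e _; apply: cfam_mul; last exact: kinP.
by rewrite -e; apply: kinP.
Qed.

Definition QLK_gamma_hom m n (f g : QLK_hom m n)
    (e : QLK_src_hom f = QLK_tgt_hom g) : QLK_hom m n :=
  QLKmor (kmap (rpr g)) (kin (rpr f) * kin (rpr g)) (kout (rpr g)) (QLK_gamma_in e).

Lemma QLK_gamma_homE m n (phi : nabla m n) u u' x y Ku Ku'
    (e : QLK_src_hom (QLKmor phi u y Ku) = QLK_tgt_hom (QLKmor phi u' x Ku')) :
  QLK_gamma_hom e = QLKmor phi (u * u') x (cfam_mul Ku Ku').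
Proof.
have [i [l [_ fu _ Ii _]]] := rpr_QLKmor y Ku.
have [i' [l' [ephi gu gx Ii' Ll']]] := rpr_QLKmor x Ku'.
apply/QLKmorP; rewrite ephi fu gu gx mulgK; split=> //.
set z := _ / _; have -> : z = i * (u * i' * u^-1).
  by rewrite /z invgM !mulgA mulgK.
have [_ IM _] := Inr_group G phi.
by apply: IM => //; apply: Inr_normal => //; apply: cfam_RSt Ku.
Qed.

(* composable pairs always have representatives as in the definition of gamma *)
Lemma QLK_gammaW m n (P : QLK_hom m n -> QLK_hom m n -> Prop) :
  (forall phi u u' x Ku Ku', P (QLKmor phi u (u' * x) Ku) (QLKmor phi u' x Ku')) ->
  forall f g, QLK_src_hom f = QLK_tgt_hom g -> P f g.
Proof.
move=> Pmor; elim/QLKmorW=> phi u y Ku; elim/QLKmorW=> phi' u' x Ku'.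
rewrite QLK_src_homE QLK_tgt_homE => /QLmorP [e Ly]; subst phi'.
rewrite (_ : QLKmor phi u y Ku = QLKmor phi u (u' * x) Ku) //.
by apply/QLKmorP; rewrite mulgV; split=> //; case: (Inr_group G phi).
Qed.

Definition QLK_cast m n m' n' (em : m = m') (en : n = n') (f : QLK_hom m n) :
    QLK_hom m' n' :=
  ecast k (QLK_hom m' k) en (ecast k (QLK_hom k n) em f).

Lemma QLK_cast_id m n (em : m = m) (en : n = n) (f : QLK_hom m n) :
  QLK_cast em en f = f.
Proof. by rewrite (Prop_irrelevance em erefl) (Prop_irrelevance en erefl). Qed.

Local Notation st_pullback := (pullback QLK_src QLK_tgt).

Lemma QLK_gamma_fmap_subproof (p q : st_pullback) (h : hom p q) :
  QLK_src_hom (QLK_cast (svalP p) (svalP q) (sval h).1) = QLK_tgt_hom (sval h).2.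
Proof.
case: p q h => [[m m'] /= em] [[n n'] /= en] [[f g] /= e]; subst m' n'.
by rewrite QLK_cast_id; apply: (@arr_inj (QL L)).
Qed.

Definition QLK_gamma_fmap (p q : st_pullback) (h : hom p q) :
    QLK_hom (sval p).2 (sval q).2 :=
  QLK_gamma_hom (QLK_gamma_fmap_subproof h).

Lemma QLK_gamma_fmapE m n (em : m = m) (en : n = n) (f g : QLK_hom m n)
    (e : Arr (fmap QLK_src (f : @hom QLK m n)) = Arr (fmap QLK_tgt (g : @hom QLK m n)))
    (e' : QLK_src_hom f = QLK_tgt_hom g) :
  @QLK_gamma_fmap (exist _ (m, m) em) (exist _ (n, n) en) (exist _ (f, g) e) =
  QLK_gamma_hom e'.
Proof.
rewrite /QLK_gamma_fmap; move: (QLK_gamma_fmap_subproof _) => /=.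
by rewrite QLK_cast_id => e''; rewrite (Prop_irrelevance e' e'').
Qed.

Lemma QLK_gamma_hom_eq m n (f g : QLK_hom m n) (e : QLK_src_hom f = QLK_tgt_hom g)
    (phi : nabla m n) u u' x y Ku Ku' :
  f = QLKmor phi u y Ku -> g = QLKmor phi u' x Ku' ->
  QLK_gamma_hom e = QLKmor phi (u * u') x (cfam_mul Ku Ku').
Proof. by move=> ef eg; subst f g; apply: QLK_gamma_homE. Qed.

Lemma QLK_gamma_comp m n p (f' g' : QLK_hom n p) (f g : QLK_hom m n)
    (e' : QLK_src_hom f' = QLK_tgt_hom g') (e : QLK_src_hom f = QLK_tgt_hom g)
    (e2 : QLK_src_hom (QLK_comp cmp f' f) = QLK_tgt_hom (QLK_comp cmp g' g)) :
  QLK_gamma_hom e2 = QLK_comp cmp (QLK_gamma_hom e') (QLK_gamma_hom e).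
Proof.
move: (e') (e) (e2); move: f' g' e' {e2}; apply: QLK_gammaW => psi v v' y Kv Kv'.
move: f g e; apply: QLK_gammaW => phi u u' x Ku Ku' e' e.
rewrite !QLK_gamma_homE !QLK_compE => e2.
have ephi : psi \oN act (v' * y) phi = psi \oN act y phi by rewrite actM (cfam_act _ Kv').
have Kg := QLK_comp_in (v' * y) Kv Ku; rewrite ephi in Kg.
rewrite (QLK_gamma_hom_eq e2 (QLKmor_eq _ Kg ephi erefl erefl) erefl).
apply: QLKmor_eq => //.
by rewrite !mulgA mulgVK.
Qed.

Definition QLK_gamma : functor st_pullback QLK.
Proof.
refine (@Functor st_pullback QLK (fun p => (sval p).2) QLK_gamma_fmap _ _).
- case=> [[m m'] /= em]; subst m'.
  have e : QLK_src_hom (@idm QLK m) = QLK_tgt_hom (@idm QLK m).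
    by rewrite QLK_src_homE QLK_tgt_homE mul1g.
  rewrite (QLK_gamma_fmapE _ _ _ e) QLK_gamma_homE; apply: QLKmor_eq => //.
  by rewrite mul1g.
- case=> [[m m'] /= em] [[n n'] /= en] [[p p'] /= ep]; subst m' n' p'.
  case=> [[f' g'] /= e'] [[f g] /= e].
  have e0 : QLK_src_hom f = QLK_tgt_hom g := @arr_inj (QL L) _ _ _ _ e.
  have e0' : QLK_src_hom f' = QLK_tgt_hom g' := @arr_inj (QL L) _ _ _ _ e'.
  have e2 : QLK_src_hom (QLK_comp cmp f' f) = QLK_tgt_hom (QLK_comp cmp g' g).
    have /= -> := fmap_comp QLK_src f' f; have /= -> := fmap_comp QLK_tgt g' g.
    by rewrite e0 e0'.
  rewrite (QLK_gamma_fmapE _ _ e e0) (QLK_gamma_fmapE _ _ e' e0').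
  rewrite -(QLK_gamma_comp e0' e0 e2).
  exact: QLK_gamma_fmapE.
Defined.

Lemma QLK_vcompE (f g : arr QLK) (e : QLK_src f = QLK_tgt g)
    m n (phi : nabla m n) u u' x y Ku Ku' :
  f = @Arr QLK m n (QLKmor phi u y Ku) -> g = @Arr QLK m n (QLKmor phi u' x Ku') ->
  vcomp QLK_gamma e = @Arr QLK m n (QLKmor phi (u * u') x (cfam_mul Ku Ku')).
Proof.
move=> ef eg; subst f g; have e' := @arr_inj (QL L) _ _ _ _ e.
by rewrite /vcomp /farr /= (QLK_gamma_fmapE _ _ _ e') QLK_gamma_homE.
Qed.

Lemma QLK_arrW (P : forall f g : arr QLK, QLK_src f = QLK_tgt g -> Prop) :
  (forall m n (phi : nabla m n) u u' x Ku Ku' e,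
     P (@Arr QLK m n (QLKmor phi u (u' * x) Ku))
       (@Arr QLK m n (QLKmor phi u' x Ku')) e) ->
  forall f g e, P f g e.
Proof.
move=> Pmor [m n f] [m' n' g] e.
have em := f_equal (@adom _) e; have en := f_equal (@acod _) e.
rewrite /= in em en; subst m' n'; move: (e).
have := @arr_inj (QL L) _ _ _ _ e; move: f g {e}.
by apply: QLK_gammaW => *; apply: Pmor.
Qed.

Theorem QLK_internal_category : internal_category QLK_gamma QLK_iota.
Proof.
have iota_srcE m n (phi : nabla m n) u x Ku :
    QLK_iota (QLK_src (@Arr QLK m n (QLKmor phi u x Ku))) =
    @Arr QLK m n (QLKmor phi 1 x (cfam_one phi)).
  by rewrite /farr /= QLK_src_homE QLK_iota_homE.
have iota_tgtE m n (phi : nabla m n) u x Ku :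
    QLK_iota (QLK_tgt (@Arr QLK m n (QLKmor phi u x Ku))) =
    @Arr QLK m n (QLKmor phi 1 (u * x) (cfam_one phi)).
  by rewrite /farr /= QLK_tgt_homE QLK_iota_homE.
split.
- case=> m n; elim/QLmorW=> phi x.
  by rewrite /farr /= QLK_iota_homE QLK_src_homE.
- case=> m n; elim/QLmorW=> phi x.
  by rewrite /farr /= QLK_iota_homE QLK_tgt_homE mul1g.
- apply: QLK_arrW => m n phi u u' x Ku Ku' e.
  by rewrite (QLK_vcompE e erefl erefl) /farr /= !QLK_src_homE.
- apply: QLK_arrW => m n phi u u' x Ku Ku' e.
  by rewrite (QLK_vcompE e erefl erefl) /farr /= !QLK_tgt_homE mulgA.
- case=> m n; elim/QLKmorW=> phi u x Ku e.
  rewrite (QLK_vcompE e erefl (iota_srcE _ _ _ _ _ _)); congr (@Arr QLK m n _).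
  by apply: QLKmor_eq; rewrite ?mulg1.
- case=> m n; elim/QLKmorW=> phi u x Ku e.
  rewrite (QLK_vcompE e (iota_tgtE _ _ _ _ _ _) erefl); congr (@Arr QLK m n _).
  by apply: QLKmor_eq; rewrite ?mul1g.
- move=> f g h fg; move: f g fg h; apply: QLK_arrW => m n phi u u' y Ku Ku' fg.
  case=> m' n' h gh; have em := f_equal (@adom _) gh; have en := f_equal (@acod _) gh.
  rewrite /= in em en; subst m' n'; have := @arr_inj (QL L) _ _ _ _ gh.
  elim/QLKmorW: h gh => phi' u'' x Ku'' gh.
  rewrite /= QLK_src_homE QLK_tgt_homE => /QLmorP [ephi _]; subst phi' => fg_h f_gh.
  rewrite (QLK_vcompE fg_h (QLK_vcompE fg erefl erefl) erefl).
  rewrite (QLK_vcompE f_gh erefl (QLK_vcompE gh erefl erefl)).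
  by congr (@Arr QLK m n _); apply: QLKmor_eq; rewrite ?mulgA.
Qed.

End QLK.

Arguments QLKmor {G K} L {m n} phi u x Ku.
Arguments QLK_comp {G K L} _ {m n p} g f : rename.

(* Replacing the representative y by l y, with l in L_psi, replaces phi^*(v)
   by (phi^l)^*(v) (up to phi^y for phi) in the second component of a composite.
   That these have the same class does not follow from [spade2] and the
   normality of [Inr]; it is the only point that these two do not settle. *)
Section Existence.
Variables (G : crossed_interval_group) (K L : congruence_family G).
Hypotheses (K_proper : proper_family K) (KL2 : spade2 K L).
Hypothesis indep : forall m n p (psi : nabla n p) (phi : nabla m n) (l v : G n),
  cfam L psi l -> cfam K psi v ->
  rcoset (Inr G (psi \oN phi)) (pull (act l phi) v) =
  rcoset (Inr G (psi \oN phi)) (pull phi v).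

Definition QLK_composition_exists : QLK_composition K L.
Proof.
refine (@QLKComposition G K L (fun m n p g f => QLKmor L _ _
  (pull (kmap (rpr f)) (kout (rpr g)) * kout (rpr f))
  (QLK_comp_in (kout (rpr g)) (kinP (rpr g)) (kinP (rpr f)))) _).
move=> m n p psi v y Kv phi u x Ku.
have [j [l [gmap gin gout Ij Ll]]] := rpr_QLKmor L y Kv.
have [i [k [fmap fin fout Ii Lk]]] := rpr_QLKmor L x Ku.
apply/QLKmorP; rewrite gmap gin gout fmap fin fout actM.
rewrite (cfam_act _ Ll); split=> //; last first.
  set z := _ / _; have -> : z =
      pull (act y phi) l * (pull phi y * k * (pull phi y)^-1).
    by rewrite /z invgM pullM !mulgA mulgK.
  apply: cfam_mul; first exact: cfam_pull_in.
  exact/cfam_compl/cfam_conj_in.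
set phi1 := act y phi; set a := pull phi y.
have [I1 IM IV] := Inr_group G (psi \oN phi1).
have Kjv : cfam K psi (j * v) by apply: cfam_mul => //; apply: Inr_proper.
have [_ /(rcosetP _ _ (Inr_group G _)) e1] :
    True /\ rcoset (Inr G (psi \oN phi1)) (pull (act l phi1) (j * v)) =
            rcoset (Inr G (psi \oN phi1)) (pull phi1 (j * v)) by split=> //; apply: indep.
have e2 : Inr G (psi \oN phi1) (pull (act v phi1) j).
  by rewrite -(cfam_act phi1 Kv); apply: Inr_pull; exists j.
have Kiu : cfam K phi1 (a * (i * u) * a^-1).
  by apply: cfam_conj_in; apply: cfam_mul => //; apply: Inr_proper.
have /(rcosetP _ _ (Inr_group G _)) e3 := KL2 Ll Kiu.
have e4 : Inr G (psi \oN phi1) (a * i * a^-1).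
  by apply: Inr_compl; apply: Inr_conj_sub; exists i.
set b := pull phi1 l in e3.
pose V := pull phi1 v.
have KV : RSt G (psi \oN phi1) V by apply: cfam_RSt; apply: cfam_pull_in; exact: Kv.
have e34 := Inr_normal KV (IM _ _ e3 e4).
set z := (X in Inr _ _ X).
suff -> : z = pull (act l phi1) (j * v) * (pull phi1 (j * v))^-1 *
    (pull (act v phi1) j * (V * (b * (a * (i * u) * a^-1) * b^-1 *
      (a * (i * u) * a^-1)^-1 * (a * i * a^-1)) * V^-1)).
  exact: IM _ _ e1 (IM _ _ e2 e34).
rewrite /z [pull phi1 (j * v)]pullM -/V mulgA [j * v * (l * y)]mulgA.
rewrite [pull phi (j * v * l * y)]pullM -/phi1 -/a [pull phi1 (j * v * l)]pullM -/b.
rewrite [pull phi (l * y)]pullM -/phi1 -/a -/b [pull phi (v * y)]pullM -/phi1 -/a -/V.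
rewrite !invgM !invgK !mulgA !(mulgK, mulgVK).
done.
Defined.

End Existence.

(* With L = Inr, all hypotheses on the pair are satisfied. *)
Section InrPair.
Variables (G : crossed_interval_group) (K : congruence_family G).
Hypothesis K_proper : proper_family K.

Lemma Inr_family_proper : proper_family (Inr_family G).
Proof.
move=> m n phi; apply/seteqP; split=> [x [Rx x1]|x [Rx Px]]; split=> // k psi psiA.
  by rewrite x1 //; case: (Inr_group G (phi \oN psi)).
have [_ /(_ _ (nabla_id k))] := Px k psi psiA.
by rewrite nabla_compmI pull_id; apply.
Qed.

Lemma Inr_conj m n (phi : nabla m n) u x :
  cfam K phi u -> Inr G phi x -> Inr G phi (u * x * u^-1).
Proof. by move/cfam_RSt; apply: Inr_normal. Qed.

Lemma Inr_family_spade1 : spade1 K (Inr_family G).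
Proof.
move=> m n phi u Ku; apply/seteqP; split=> [_ [x Ix <-]|x Ix]; first exact: Inr_conj.
have [_ _ /(_ _ Ku) KuV] := cfam_group K phi.
exists (u^-1 * x * u); last by rewrite !mulgA mulgV mul1g mulgK.
by rewrite -[X in _ * X]invgK; apply: Inr_conj.
Qed.

Lemma Inr_family_spade2 : spade2 K (Inr_family G).
Proof.
move=> m n p psi phi u x Iu Kx; have gI := Inr_group G (psi \oN phi).
have [_ IM IV] := gI; apply/rcosetP => //.
have Ib : Inr G (psi \oN phi) (pull phi u) by apply: Inr_pull; exists u.
rewrite -!mulgA; apply: (IM _ _ Ib); rewrite mulgA.
by apply: Inr_conj; [exact: cfam_compl|exact: IV].
Qed.

Definition Inr_family_composition : QLK_composition K (Inr_family G).
Proof.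
apply: QLK_composition_exists => //; first exact: Inr_family_spade2.
move=> m n p psi phi l v Il Kv; have gI := Inr_group G (psi \oN phi).
have [_ IM IV] := gI; apply/rcosetP => //.
have -> : pull (act l phi) v =
    pull (act v phi) (v * l * v^-1) * (pull phi v * (pull phi l)^-1).
  by rewrite mulgA -pullM mulgVK pullM mulgK.
rewrite -[X in Inr _ _ X]mulgA; apply: IM.
  rewrite -(cfam_act phi Kv); apply: Inr_pull.
  by exists (v * l * v^-1) => //; apply: Inr_conj.
apply: (@Inr_conj _ _ (psi \oN phi)); first exact: cfam_pull_in.
by apply: IV; apply: Inr_pull; exists l.
Defined.

End InrPair.

(* Main.v *)
(* A map phi of nabla factors as (phi sigma) rho, where sigma includes the interval
   of interior points that phi sends to interior points; phi sigma is active and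
   every theta with phi theta active satisfies sigma rho theta = theta. Hence every
   f in Q_L has h, r with f h active, f h r = f, and i(h r) c = c for each c in
   Q_(L//K) with f s(c) active. So f ~ f' implies f' h r = f, which gives that iota
   descends; and if s(f) ~ g, then f ~ f i(h r), which has source exactly g. Thus
   composable classes have composable representatives, gamma descends by the
   interchange law, and the axioms are inherited. *)
Require Import Defs.
From mathcomp Require Import all_boot.
From mathcomp Require Import boolp.
From mathcomp Require Import zify.

Set Implicit Arguments.
Unset Strict Implicit.
Unset Printing Implicit Defensive.

Local Open Scope group_scope.

(** * Factorization of a map of nabla through its active part *)

Lemma upward_closed_ord n (P : pred 'I_n.+1) :
  P ord_max -> (forall i j : 'I_n.+1, (i <= j)%N -> P i -> P j) ->
  exists a : 'I_n.+1, forall i, P i = (a <= i)%N.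
Proof.
move=> PT Pup; case: (@arg_minnP _ ord_max P (fun i => i : nat) PT) => a Pa a_min.
by exists a => i; apply/idP/idP => [/a_min|/Pup]; last exact.
Qed.

(* The interior points of <<m>> that phi sends to interior points form an interval
   a, ..., b - 1, onto which rho collapses <<m>> and whose inclusion is sigma. *)
Lemma inert_active m n (phi : nabla m n) :
  exists k (sigma : nabla k m) (rho : nabla m k),
    [/\ active (phi \oN sigma), phi \oN sigma \oN rho = phi
      & forall l (theta : nabla l m),
          active (phi \oN theta) -> sigma \oN rho \oN theta = theta].
Proof.
have leT p (i : 'I_p.+1) : (i <= p)%N by rewrite -ltnS.
(* [a] is the first point that [phi] does not send to the bottom, and [b] below is the first that it
   sends to the top. *)
have [a Pa] : exists a : 'I_m.+2, forall i, (phi i != ord0) = (a <= i)%N.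
  apply: (upward_closed_ord (P := fun i => phi i != ord0)) => [|i j ij].
    by rewrite nablaT.
  apply: contra => /eqP j0; have := nabla_mono phi ij.
  by rewrite j0 leqn0 -val_eqE.
have [b Pb] : exists b : 'I_m.+2, forall i, (phi i == ord_max) = (b <= i)%N.
  apply: (upward_closed_ord (P := fun i => phi i == ord_max)) => [|i j ij].
    by rewrite nablaT.
  move=> /eqP i1; have := nabla_mono phi ij.
  by rewrite i1 -val_eqE eqn_leq leT => ->.
have a_gt0 : (0 < a)%N by have := Pa ord0; rewrite nabla0 eqxx /=; case: (nat_of_ord a).
have a_b : (a <= b)%N by rewrite -Pa; have := Pb b; rewrite leqnn => /eqP->.
have b_m := leT _ b; set k := (b - a)%N.
(* The [k] interior points 1, ..., k go to a, ..., b - 1, hence the offset [a.-1]. *)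
pose s (j : 'I_k.+2) : nat :=
  if j == 0%N :> nat then 0%N else if j == k.+1 :> nat then m.+1 else (a.-1 + j)%N.
have s_lt j : (s j < m.+2)%N by rewrite /s; have := leT _ j; do !case: eqP; lia.
(* Truncated subtraction sends the points below [a] to 0, and the minimum caps those from [b] on at
   [k.+1]. *)
pose r (i : 'I_m.+2) : nat := minn (i.+1 - a) k.+1.
have r_lt i : (r i < k.+2)%N by rewrite /r; lia.
have s0 : Ordinal (s_lt ord0) = ord0 by apply: val_inj.
have sT : Ordinal (s_lt ord_max) = ord_max by apply: val_inj; rewrite /= /s /= eqxx.
have s_mono (i j : 'I_k.+2) :
    (i <= j)%N -> (Ordinal (s_lt i) <= Ordinal (s_lt j))%N.
  by rewrite /= /s; have := leT _ i; have := leT _ j; do !case: eqP; lia.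
have r0 : Ordinal (r_lt ord0) = ord0 by apply: val_inj; rewrite /= /r /=; lia.
have rT : Ordinal (r_lt ord_max) = ord_max by apply: val_inj; rewrite /= /r /=; lia.
have r_mono (i j : 'I_m.+2) :
    (i <= j)%N -> (Ordinal (r_lt i) <= Ordinal (r_lt j))%N by rewrite /= /r; lia.
exists k, (mk_nabla s0 sT s_mono), (mk_nabla r0 rT r_mono).
have sr i : ((mk_nabla s0 sT s_mono \oN mk_nabla r0 rT r_mono) i =
    (if i < a then 0 else if b <= i then m.+1 else i) :> nat)%N.
  rewrite nabla_compE !ffunE /= /s /r /=; have := leT _ i.
  by do !case: ifP; lia.
have bdryE i : boundary (phi i) = (i < a)%N || (b <= i)%N.
  by rewrite /boundary Pb -[_ == ord0]negbK Pa -ltnNge.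
split.
- apply/activeP=> j; rewrite nabla_compE bdryE ffunE boundary_val /= /s.
  by have := leT _ j; do !case: eqP; lia.
- apply: nablaP => i; rewrite -nabla_compA nabla_compE.
  set j := (_ \oN _) i; have := sr i; rewrite -/j.
  case: ifP => [ia ej|_].
    have -> : j = ord0 by apply: val_inj.
    by rewrite nabla0; apply/esym/eqP; rewrite -[_ == _]negbK Pa -ltnNge.
  case: ifP => [bi ej|_ /val_inj -> //].
  have -> : j = ord_max by apply: val_inj.
  by rewrite nablaT; apply/esym/eqP; rewrite Pb.
- move=> l theta /activeP thA; apply: nablaP => i; apply: val_inj.
  rewrite nabla_compE; apply: (etrans (sr _)); have [bi|ibdry] := boolP (boundary i).
    case/orP: bi => /eqP ->; rewrite ?nabla0 ?nablaT ?a_gt0 //=.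
    by rewrite ltnNge (leq_trans a_b b_m) b_m.
  (* As [phi \oN theta] is active, [theta] sends interior points between a and b - 1, where
     [sigma \oN rho] is the identity. *)
  have := contra (thA i) ibdry; rewrite nabla_compE bdryE negb_or.
  by case/andP=> /negbTE -> /negbTE ->.
Qed.

(** * Functors induced on quotient categories *)

Section QuotientLift.
Variables (C D : category).
Variables (A : forall a b : C, hom a b -> Prop) (B : forall a b : D, hom a b -> Prop).
Hypothesis A_cancel : forall (a b c : C) (g : hom b c) (f : hom a b),
  A (g \oC f) -> A f.
Hypothesis B_cancel : forall (a b c : D) (g : hom b c) (f : hom a b),
  B (g \oC f) -> B f.
Variable F : functor C D.
Hypothesis F_qsim : forall (a b : C) (f f' : hom a b),
  qsim A f f' -> qsim B (fmap F f) (fmap F f').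

Definition quotient_lift_hom (a b : C) (f : quot_hom A a b) :
    quot_hom B (fob F a) (fob F b) :=
  cls _ (fmap F (rpr f)).

Lemma quotient_lift_homE (a b : C) (f : hom a b) :
  quotient_lift_hom (cls (qsim_equiv A a b) f) = cls (qsim_equiv B _ _) (fmap F f).
Proof. by apply/clsE/F_qsim/(rpr_cls (qsim_equiv A a b)). Qed.

Definition quotient_lift :
  functor (quotient_category A_cancel) (quotient_category B_cancel).
Proof.
refine (@Functor (quotient_category A_cancel) (quotient_category B_cancel)
  (fob F) quotient_lift_hom _ _).
- by move=> a; rewrite quotient_lift_homE fmap_id.
- move=> a b c g f; rewrite -(rprK g) -(rprK f) /= quot_compE //.
  by rewrite !quotient_lift_homE fmap_comp quot_compE.
Defined.

End QuotientLift.

Lemma quotient_functor_surj (C : category) (A : forall a b : C, hom a b -> Prop)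
    (A_cancel : forall (a b c : C) (g : hom b c) (f : hom a b),
       A _ _ (g \oC f) -> A _ _ f)
    (F : arr (quotient_category A_cancel)) :
  exists f, F = quotient_functor A_cancel f.
Proof. by case: F => a b f; exists (Arr (rpr f)); rewrite /farr /= rprK. Qed.

Section Descent.
Variables (G : crossed_interval_group) (K L : congruence_family G).
Hypotheses (L_proper : proper_family L) (KL1 : spade1 K L).
Variable cmp : QLK_composition K L.

Local Notation QK := (QLK cmp).
Local Notation Q := (QL L).
Local Notation s := (QLK_src cmp).
Local Notation t := (QLK_tgt cmp L_proper KL1).
Local Notation i := (QLK_iota cmp).
Local Notation simK := (qsim (@QLK_active G K L cmp)).
Local Notation simQ := (qsim (@QL_active G L)).

(** * Compatibility of s, t and iota with the congruences *)

Lemma QL_src_active (m n : QK) (f : hom m n) :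
  QL_active (fmap s f) = QLK_active f.
Proof.
elim/QLKmorW: f => phi u x Ku.
by rewrite /QL_active /QLK_active /= QLK_src_homE QL_mapE QLK_mapE.
Qed.

Lemma QL_tgt_active (m n : QK) (f : hom m n) :
  QL_active (fmap t f) = QLK_active f.
Proof.
elim/QLKmorW: f => phi u x Ku.
by rewrite /QL_active /QLK_active /= QLK_tgt_homE // QL_mapE QLK_mapE.
Qed.

Lemma src_iota (m n : Q) (f : hom m n) : fmap s (fmap i f) = f.
Proof. exact: arr_inj (src_id (QLK_internal_category cmp L_proper KL1) (Arr f)). Qed.

Lemma tgt_iota (m n : Q) (f : hom m n) : fmap t (fmap i f) = f.
Proof. exact: arr_inj (tgt_id (QLK_internal_category cmp L_proper KL1) (Arr f)). Qed.

(** Every test morphism [h] of [Q] is the source of [fmap i h], and s preserves and reflects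
    activity, so the hypothesis can be applied to [fmap i h]. The same works for t. *)
Lemma qsim_src (m n : QK) (f f' : hom m n) :
  simK f f' -> simQ (fmap s f) (fmap s f').
Proof.
move=> ff' z h; rewrite -(src_iota h) -!(fmap_comp s) !QL_src_active.
by move/ff' ->.
Qed.

Lemma qsim_tgt (m n : QK) (f f' : hom m n) :
  simK f f' -> simQ (fmap t f) (fmap t f').
Proof.
move=> ff' z h; rewrite -(tgt_iota h) -!(fmap_comp t) !QL_tgt_active.
by move/ff' ->.
Qed.

(** Write f as phi after x, where x stands for the invertible morphism (id, [x]). Then [h] is sigma
    followed by the inverse of x, and [r] is x followed by rho, so f h is phi sigma and f h r is
    f. *)
Lemma QL_inert_active (m n : Q) (f : hom m n) :
  exists (k : Q) (h : hom k m) (r : hom m k),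
    [/\ QL_active (f \oC h), f \oC h \oC r = f
      & forall (l : QK) (c : @hom QK l m),
          QL_active (f \oC fmap s c) -> fmap i (h \oC r) \oC c = c].
Proof.
elim/QLmorW: f => phi x; have [k [sigma [rho [phiA phiE rhoE]]]] := inert_active phi.
have hr : QL_comp (QLmor L (act x^-1 sigma) (pull sigma x^-1)) (QLmor L rho x) =
    QLmor L (act x^-1 (sigma \oN rho)) (pull (sigma \oN rho) x^-1 * x).
  by rewrite QL_compE -act_comp -pull_comp.
exists k, (QLmor L (act x^-1 sigma) (pull sigma x^-1)), (QLmor L rho x); split.
- by rewrite /QL_active /= QL_compE QL_mapE actVK.
- rewrite -Defs.compA /= hr QL_compE actVK nabla_compA phiE.
  by rewrite mulgA -pullM mulgV pull1 mul1g.
- move=> l; elim/QLKmorW=> chi w z Kw.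
  (* The map underlying f s(c) is phi after [act x chi], so [rhoE] applies to theta =
     [act x chi]. *)
  rewrite /QL_active /= QLK_src_homE QL_compE QL_mapE => /rhoE chiE.
  rewrite hr QLK_iota_homE QLK_compE.
  have act_chi : act x^-1 (sigma \oN rho) \oN
      act (pull (sigma \oN rho) x^-1 * x) chi = chi.
    by rewrite actM -act_comp chiE actK.
  have pull_chi : pull chi (pull (sigma \oN rho) x^-1 * x) = 1.
    by rewrite pullM -pull_comp chiE -pullM mulVg pull1.
  by apply: QLKmor_eq => //; rewrite ?mul1g pull_chi ?invg1 ?mulg1 mul1g.
Qed.

(** The test morphism [c] lives in [QK], where the hypothesis says nothing directly. Inserting
    iota(h r) in front of [c] reduces the claim to f h = f' h, an equality in [Q]. *)
Lemma qsim_iota (m n : Q) (f f' : hom m n) :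
  simQ f f' -> simK (fmap i f) (fmap i f').
Proof.
move=> ff' l c; rewrite -!QL_src_active !(fmap_comp s) !src_iota => Ac.
have fcA : QL_active (f \oC fmap s c) by case: Ac (ff' _ _ Ac) => // Ac ->.
have [k [h [r [fhA fhr hrK]]]] := QL_inert_active f.
rewrite -(hrK _ _ fcA) !Defs.compA -!(fmap_comp i) !Defs.compA.
by rewrite (ff' _ _ (or_introl fhA)).
Qed.

(* Needed because a pair of classes composable in the quotient need not come with
   composable representatives. *)
Lemma qsim_lift_src (m n : QK) (f : hom m n) (g : @hom Q m n) :
  simQ (fmap s f) g -> exists2 f', simK f f' & fmap s f' = g.
Proof.
move=> fg; have [k [h [r [ghA ghr hrK]]]] := QL_inert_active g.
exists (f \oC fmap i (h \oC r)); last first.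
  by rewrite (fmap_comp s) src_iota Defs.compA (fg _ _ (or_intror ghA)).
move=> l c; rewrite -!QL_src_active => Ac.
(* If g s(c) is active, then iota(h r) c = c. Both cases give this: s(f) s(c) agrees with g s(c) by
   the hypothesis, and s(f) h r equals g. *)
suff /hrK e : QL_active (g \oC fmap s c) by rewrite -Defs.compA e.
case: Ac; rewrite !(fmap_comp s) ?src_iota.
  by move=> Ac; rewrite -(fg _ _ (or_introl Ac)).
by rewrite [_ \oC (h \oC r)]Defs.compA (fg _ _ (or_intror ghA)) ghr.
Qed.

(** * Vertical composites of equivalent morphisms *)

Lemma src_gamma m n (f g : QLK_hom K L m n) (e : QLK_src_hom f = QLK_tgt_hom g) :
  QLK_src_hom (QLK_gamma_hom e) = QLK_src_hom g.
Proof.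
move: (e); move: f g e; apply: (QLK_gammaW L_proper KL1) => phi u u' x Ku Ku' e.
by rewrite QLK_gamma_homE !QLK_src_homE.
Qed.

Lemma gamma_id n (e : QLK_src_hom (@idm QK n) = QLK_tgt_hom (@idm QK n)) :
  QLK_gamma_hom e = @idm QK n.
Proof. by rewrite QLK_gamma_homE; apply: QLKmor_eq; rewrite // mul1g. Qed.

Lemma gamma_iota_tgt m n (f : QLK_hom K L m n)
    (e : QLK_src_hom (QLK_iota_hom K (QLK_tgt_hom f)) = QLK_tgt_hom f) :
  QLK_gamma_hom e = f.
Proof.
elim/QLKmorW: f e => phi u x Ku e.
have iE : QLK_iota_hom K (QLK_tgt_hom (QLKmor L phi u x Ku)) =
    QLKmor L phi 1 (u * x) (cfam_one K phi) by rewrite QLK_tgt_homE // QLK_iota_homE.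
by rewrite (QLK_gamma_hom_eq e iE erefl); apply: QLKmor_eq; rewrite // mul1g.
Qed.

(* By the interchange law, gamma(f, g) \oC c = gamma(f \oC i(t c), g \oC c). *)
Lemma qsim_gamma m n (f f' g g' : QLK_hom K L m n)
    (e : QLK_src_hom f = QLK_tgt_hom g) (e' : QLK_src_hom f' = QLK_tgt_hom g') :
  simK (f : @hom QK m n) f' -> simK (g : @hom QK m n) g' ->
  simK (QLK_gamma_hom e : @hom QK m n) (QLK_gamma_hom e').
Proof.
move=> ff' gg' l c; set c' := fmap i (fmap t c).
have srcE (p q : QLK_hom K L m n) (epq : QLK_src_hom p = QLK_tgt_hom q) :
    QLK_src_hom (QLK_comp cmp p c') = QLK_tgt_hom (QLK_comp cmp q c).
  have /= -> := fmap_comp s p c'; have /= -> := fmap_comp t q c.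
  by rewrite epq; congr QL_comp; apply: src_iota.
have interchange (p q : QLK_hom K L m n) (epq : QLK_src_hom p = QLK_tgt_hom q) :
    QLK_comp cmp (QLK_gamma_hom epq) c = QLK_gamma_hom (srcE p q epq).
  rewrite (QLK_gamma_comp L_proper KL1 epq (src_iota (fmap t c))).
  by rewrite gamma_iota_tgt.
(* Activity of a composite with gamma(p, q) is read off q through the common source, and then off p
   because s(p) = t(q). *)
have activeE (p q : QLK_hom K L m n) (epq : QLK_src_hom p = QLK_tgt_hom q) :
    QLK_active ((QLK_gamma_hom epq : @hom QK m n) \oC c) =
    QLK_active ((q : @hom QK m n) \oC c).
  by rewrite -!QL_src_active !(fmap_comp s) /= src_gamma.
have activeE' (p q : QLK_hom K L m n) (epq : QLK_src_hom p = QLK_tgt_hom q) :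
    QLK_active ((q : @hom QK m n) \oC c) = QLK_active ((p : @hom QK m n) \oC c').
  rewrite -QL_tgt_active -QL_src_active (fmap_comp s) (fmap_comp t) /c' src_iota.
  by rewrite /= epq.
rewrite !activeE => Ac; have eg := gg' _ _ Ac.
rewrite (activeE' _ _ e) (activeE' _ _ e') in Ac; have ef := ff' _ _ Ac.
rewrite /= (interchange _ _ e) (interchange _ _ e').
(* The composability proofs mention the composites being rewritten, so they are generalized first
   and identified afterwards by proof irrelevance. *)
move: (srcE _ _ e) (srcE _ _ e'); rewrite /= in ef eg; rewrite ef eg => e1 e2.
by rewrite (Prop_irrelevance e1 e2).
Qed.

(** * The induced functors and the lifting of composable pairs *)

Definition tsrc : functor (tQLK cmp) (tQL L) :=
  quotient_lift (QLK_active_cancel (cmp := cmp)) (QL_active_cancel (L := L)) qsim_src.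

Definition ttgt : functor (tQLK cmp) (tQL L) :=
  quotient_lift (QLK_active_cancel (cmp := cmp)) (QL_active_cancel (L := L)) qsim_tgt.

Definition tiota : functor (tQL L) (tQLK cmp) :=
  quotient_lift (QL_active_cancel (L := L)) (QLK_active_cancel (cmp := cmp)) qsim_iota.

Lemma tsrcE (f : arr QK) : tsrc (piQLK cmp f) = piQL L (s f).
Proof. by case: f => m n f; rewrite /farr /= quotient_lift_homE //; apply: qsim_src. Qed.

Lemma ttgtE (f : arr QK) : ttgt (piQLK cmp f) = piQL L (t f).
Proof. by case: f => m n f; rewrite /farr /= quotient_lift_homE //; apply: qsim_tgt. Qed.

Lemma tiotaE (f : arr Q) : tiota (piQL L f) = piQLK cmp (i f).
Proof. by case: f => m n f; rewrite /farr /= quotient_lift_homE //; apply: qsim_iota. Qed.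

Lemma piQLK_eq (m n : QK) (f f' : hom m n) :
  piQLK cmp (Arr f) = piQLK cmp (Arr f') <-> simK f f'.
Proof.
split=> [/(@arr_inj (tQLK cmp)) /clsE //|ff'].
by rewrite /farr /=; congr (@Arr (tQLK cmp) _ _ _); apply/clsE.
Qed.

Lemma lift_src (f : arr QK) (g : arr Q) : piQL L (s f) = piQL L g ->
  exists2 f', piQLK cmp f' = piQLK cmp f & s f' = g.
Proof.
case: f g => m n f [m' n' g] e.
have em := f_equal (@adom _) e; have en := f_equal (@acod _) e.
rewrite /= in em en; subst m' n'; have /clsE fg := @arr_inj (tQL L) _ _ _ _ e.
have [f' ff' f'g] := qsim_lift_src fg; exists (Arr f'); last exact: (f_equal (@Arr Q m n) f'g).
exact/esym/piQLK_eq.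
Qed.

(** The lift of [H] is arbitrary; only the lift of [F] is changed within its class to match it. *)
Lemma tcomposable (F H : arr (tQLK cmp)) : tsrc F = ttgt H ->
  exists f h, [/\ s f = t h, F = piQLK cmp f & H = piQLK cmp h].
Proof.
have [f ->] := quotient_functor_surj F; have [h ->] := quotient_functor_surj H.
rewrite -/(piQLK cmp) tsrcE ttgtE => /lift_src [f' ff' e].
by exists f', h; rewrite ff'.
Qed.

(** * Vertical composition on the quotient *)

Local Notation tpullback := (pullback tsrc ttgt).

(* Arrows with their endpoints are compared because the two components of h have
   endpoints that are only propositionally equal. *)
Definition tgamma_spec (p q : tpullback) (h : hom p q)
    (c : @hom (tQLK cmp) (sval p).2 (sval q).2) : Prop :=
  forall m n (f g : QLK_hom K L m n) (e : QLK_src_hom f = QLK_tgt_hom g),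
    piQLK cmp (@Arr QK m n f) = Arr (sval h).1 ->
    piQLK cmp (@Arr QK m n g) = Arr (sval h).2 ->
    Arr c = piQLK cmp (@Arr QK m n (QLK_gamma_hom e)).

Lemma tpullback_rep (p q : tpullback) (h : hom p q) :
  exists m n (f g : QLK_hom K L m n),
    [/\ QLK_src_hom f = QLK_tgt_hom g,
        Arr (sval h).1 = piQLK cmp (@Arr QK m n f)
      & Arr (sval h).2 = piQLK cmp (@Arr QK m n g)].
Proof.
have [[m n f] [[m' n' g] [e ef eg]]] :=
  @tcomposable (Arr (sval h).1) (Arr (sval h).2) (svalP h).
have em := f_equal (@adom _) e; have en := f_equal (@acod _) e.
rewrite /= in em en; subst m' n'.
by exists m, n, f, g; split=> //; apply: (@arr_inj Q) e.
Qed.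

Lemma tgamma_exists (p q : tpullback) (h : hom p q) : exists c, tgamma_spec h c.
Proof.
have [m [n [f [g [e ef eg]]]]] := tpullback_rep h.
have em := f_equal (@adom _) eg; have en := f_equal (@acod _) eg.
have em1 := f_equal (@adom _) ef; have en1 := f_equal (@acod _) ef.
case: p q h ef eg em en em1 en1 => [[m1 m2] p] [[n1 n2] q] [[F H] FH] ef eg.
rewrite /= in p q F H FH ef eg * => em en em1 en1; subst m1 m2 n1 n2.
(* Any other composable representatives are equivalent to [f] and [g], so [qsim_gamma] identifies
   the two composites. *)
exists (fmap (piQLK cmp) (QLK_gamma_hom e : @hom QK m n)) => m' n' f' g' e' /= ef' eg'.
rewrite {}ef in ef'; rewrite {}eg in eg'.
have em := f_equal (@adom _) ef'; have en := f_equal (@acod _) ef'.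
rewrite /= in em en; subst m' n'.
apply/piQLK_eq/qsim_gamma; exact/piQLK_eq/esym.
Qed.

(** The value is picked by choice, but [tgamma_spec] determines it, since [tpullback_rep] supplies
    representatives. *)
Definition tgamma_fmap (p q : tpullback) (h : hom p q) :
    @hom (tQLK cmp) (sval p).2 (sval q).2 :=
  sval (cid (tgamma_exists h)).

Lemma tgamma_fmapP (p q : tpullback) (h : hom p q) : tgamma_spec h (tgamma_fmap h).
Proof. exact: (svalP (cid (tgamma_exists h))). Qed.

Definition tgamma : functor tpullback (tQLK cmp).
Proof.
refine (@Functor tpullback (tQLK cmp) (fun p => (sval p).2) tgamma_fmap _ _).
- case=> [[m m'] em]; have em' : m = m' := em; subst m'.
  have e : QLK_src_hom (@idm QK m) = QLK_tgt_hom (@idm QK m).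
    by have /= -> := fmap_id s m; have /= -> := fmap_id t m.
  have := tgamma_fmapP (h := @idm tpullback (exist _ (m, m) em)) e erefl erefl.
  by rewrite gamma_id; apply: (@arr_inj (tQLK cmp)).
- move=> p q r k h.
  have [m [n [f [g [e ef eg]]]]] := tpullback_rep h.
  have [n' [l [f' [g' [e' ef' eg']]]]] := tpullback_rep k.
  have en : n' = n.
    have := f_equal (@acod _) eg; have := f_equal (@adom _) eg'.
    by move=> /= <- <-.
  subst n'.
  have e2 : QLK_src_hom (QLK_comp cmp f' f) = QLK_tgt_hom (QLK_comp cmp g' g).
    have /= -> := fmap_comp s f' f; have /= -> := fmap_comp t g' g.
    by rewrite e e'.
  have pi_comp (x : @hom QK n l) (y : @hom QK m n) :
     piQLK cmp (Arr (x \oC y)) = Arr (fmap (piQLK cmp) x \oC fmap (piQLK cmp) y).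
    exact: (f_equal (@Arr (tQLK cmp) m l) (fmap_comp (piQLK cmp) x y)).
  (* Composites of representatives represent the composite, so functoriality reduces to the
     interchange law [QLK_gamma_comp]. *)
  apply: (@arr_inj (tQLK cmp)); apply: (etrans (tgamma_fmapP (h := k \oC h) e2 _ _)).
  + by rewrite (pi_comp f' f); apply: (@arr_comp (tQLK cmp)).
  + by rewrite (pi_comp g' g); apply: (@arr_comp (tQLK cmp)).
  rewrite (QLK_gamma_comp L_proper KL1 e' e) pi_comp.
  by apply: (@arr_comp (tQLK cmp)); apply/esym/tgamma_fmapP.
Defined.

(** Any composable representatives compute the composite, which transfers each axiom from [QK] to
    the quotient. *)
Lemma tvcompE (F H : arr (tQLK cmp)) (e' : tsrc F = ttgt H) (f g : arr QK)
    (e : s f = t g) :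
  F = piQLK cmp f -> H = piQLK cmp g ->
  vcomp tgamma e' = piQLK cmp (vcomp (QLK_gamma cmp L_proper KL1) e).
Proof.
case: f g e => m n f [m' n' g] e ef eg.
have em := f_equal (@adom _) e; have en := f_equal (@acod _) e.
rewrite /= in em en; subst m' n'; have e0 := @arr_inj Q _ _ _ _ e.
apply: (etrans (tgamma_fmapP e0 _ _)).
- by rewrite -ef /=; case: F {e' ef}.
- by rewrite -eg /=; case: H {e' eg}.
by rewrite /vcomp /farr /= (QLK_gamma_fmapE _ _ _ e0).
Qed.

Theorem tQLK_internal_category : internal_category tgamma tiota.
Proof.
have [sI tI sV tV Vr Vl VA] := QLK_internal_category cmp L_proper KL1.
split.
- move=> F; have [f ->] := quotient_functor_surj F.
  by rewrite -/(piQL L) tiotaE tsrcE sI.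
- move=> F; have [f ->] := quotient_functor_surj F.
  by rewrite -/(piQL L) tiotaE ttgtE tI.
- move=> F H e'; have [f [h [e eF eH]]] := tcomposable e'.
  by rewrite (tvcompE e' e eF eH) eH !tsrcE sV.
- move=> F H e'; have [f [h [e eF eH]]] := tcomposable e'.
  by rewrite (tvcompE e' e eF eH) eF !ttgtE tV.
- move=> F e'; have [f eF] : exists f, F = piQLK cmp f by apply: quotient_functor_surj.
  have e : s f = t (i (s f)) by rewrite tI.
  by rewrite (tvcompE e' e eF) ?Vr // eF tsrcE tiotaE.
- move=> F e'; have [f eF] : exists f, F = piQLK cmp f by apply: quotient_functor_surj.
  have e : s (i (t f)) = t f by rewrite sI.
  by rewrite (tvcompE e' e _ eF) ?Vl // eF ttgtE tiotaE.
- move=> F H J FH HJ FH_J F_HJ.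
  (* Lifting changes only the left factor of a pair. The right pair is therefore lifted first, and
     the lift of [F] is then adjusted to [h], which keeps all three composable. *)
  have [h [j [hj eH eJ]]] := tcomposable HJ.
  have [f eF] : exists f, F = piQLK cmp f by apply: quotient_functor_surj.
  have [f' ff' fh] : exists2 f', piQLK cmp f' = piQLK cmp f & s f' = t h.
    by apply: lift_src; rewrite -tsrcE -ttgtE -eF -eH.
  rewrite -ff' in eF.
  have fh_j : s (vcomp (QLK_gamma cmp L_proper KL1) fh) = t j by rewrite sV.
  have f_hj : s f' = t (vcomp (QLK_gamma cmp L_proper KL1) hj) by rewrite tV.
  rewrite (tvcompE FH_J fh_j (tvcompE FH fh eF eH) eJ).
  by rewrite (tvcompE F_HJ f_hj eF (tvcompE HJ hj eH eJ)) (VA _ _ _ fh hj).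
Qed.

End Descent.

Theorem proposition3p10 (G : crossed_interval_group) (K L : congruence_family G)
    (K_proper : proper_family K) (L_proper : proper_family L)
    (KL1 : spade1 K L) (KL2 : spade2 K L) (cmp : QLK_composition K L) :
  let s := QLK_src cmp in
  let t := QLK_tgt cmp L_proper KL1 in
  let gamma := QLK_gamma cmp L_proper KL1 in
  let iota := QLK_iota cmp in
  exists (s' t' : functor (tQLK cmp) (tQL L))
         (gamma' : functor (pullback s' t') (tQLK cmp))
         (iota' : functor (tQL L) (tQLK cmp)),
    [/\ forall f : arr (QLK cmp), s' (piQLK cmp f) = piQL L (s f),
        forall f : arr (QLK cmp), t' (piQLK cmp f) = piQL L (t f),
        forall f : arr (QL L), iota' (piQL L f) = piQLK cmp (iota f),
        forall (f g : arr (QLK cmp)) (e : s f = t g)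
               (e' : s' (piQLK cmp f) = t' (piQLK cmp g)),
          vcomp gamma' e' = piQLK cmp (vcomp gamma e)
      & internal_category gamma' iota'].
Proof.
exists (tsrc L_proper KL1 cmp), (ttgt L_proper KL1 cmp), (tgamma L_proper KL1 cmp).
exists (tiota L_proper KL1 cmp); split.
- exact: tsrcE.
- exact: ttgtE.
- exact: tiotaE.
- by move=> f g e e'; apply: tvcompE.
- exact: tQLK_internal_category.
Qed.
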